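(* Let Spitzer's condition be satisfied: there exists a $\rho\in(0,1)$ such that $\frac1n\sum_{k=1}^n\mathbf{P}(S_k>0)\to\rho$ as $n\to\infty$. Then $$\lim_{j,\,n-j\to \infty } \frac{\mathbf{E}\, N_n (j)}{(n-j)\,\mathbf{P} (\widetilde{M}_{j}<0)\, \mathbf{P} (L_{n-j}\ge 0)}=\frac{1}{\rho },$$ where the limit is taken as $\min\{j,n-j\}\to\infty$.
   Context: Let $\theta_1,\theta_2,\dots$ be i.i.d. real random variables, $S_0=0$, $S_n=\theta_1+\dots+\theta_n$; $L_n:=\min_{0\le k\le n}S_k$, $\widetilde M_n:=\max_{1\le k\le n}S_k$. Tree: weights $w(j):=e^{-S_j}$, $j\ge0$; starting from the root $v(0)$, at step $n\ge1$ a vertex $v(n)$ is attached as a child of $v(n^* )$, where, given the weights and independently of all earlier choices, $n^*\in\{0,\dots,n-1\}$ equals $i$ with probability $w(i)/\sum_{q=0}^{n-1}w(q)$. The outdegree of $v(j)$ after $n$ steps is $N_n(j):=\sum_{k=j+1}^n I\{k^*=j\}$, $0\le j\le n$. *)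

(* Defs.v *)
From HB Require Import structures.
From mathcomp Require Import all_boot all_order all_algebra.
From mathcomp Require Import finmap.
From mathcomp Require Import all_classical all_reals all_analysis.

Set Implicit Arguments.
Unset Strict Implicit.
Unset Printing Implicit Defensive.

Import Order.TTheory GRing.Theory Num.Theory.
Import numFieldNormedType.Exports.

Local Open Scope classical_set_scope.
Local Open Scope ring_scope.

Definition mutually_independent (d : measure_display) (T : measurableType d)
    (R : realType) (P : probability T R) (X : nat -> {RV P >-> R}) : Prop :=
  forall (J : {fset nat}) (B : nat -> set R), (forall i, measurable (B i)) ->
    P (\bigcap_(i in [set` J]) (X i @^-1` B i)) =
    (\prod_(i <- J) P (X i @^-1` B i))%E.

Definition identically_distributed (d : measure_display) (T : measurableType d)
    (R : realType) (P : probability T R) (X : nat -> {RV P >-> R}) : Prop :=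
  forall i j (B : set R), measurable B ->
    distribution P (X i) B = distribution P (X j) B.

Definition iid (d : measure_display) (T : measurableType d)
    (R : realType) (P : probability T R) (X : nat -> {RV P >-> R}) : Prop :=
  mutually_independent X /\ identically_distributed X.

(* The steps are indexed from 0: [theta i] is the (i+1)-st step of the walk,
   so that S_n = theta 0 + ... + theta n.-1. *)
Definition walk (T : Type) (R : realType) (theta : nat -> T -> R)
    (n : nat) (x : T) : R :=
  \sum_(i < n) theta i x.

(* L_n, the minimum over 0 <= k <= n *)
Definition walk_min (T : Type) (R : realType) (S : nat -> T -> R)
    (n : nat) (x : T) : R :=
  \big[Num.min/S 0%N x]_(0 <= k < n.+1) S k x.

(* The maximum over 1 <= k <= n, excluding time 0. It is meaningful only for
   1 <= n; for n = 0 the value is the dummy S_1. *)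
Definition walk_max1 (T : Type) (R : realType) (S : nat -> T -> R)
    (n : nat) (x : T) : R :=
  \big[Num.max/S 1%N x]_(1 <= k < n.+1) S k x.

Definition spitzer (d : measure_display) (T : measurableType d)
    (R : realType) (P : probability T R) (S : nat -> T -> R) (rho : R) : Prop :=
  (fun n : nat =>
     n%:R^-1 * \sum_(1 <= k < n.+1) fine (P [set x | 0 < S k x]))
    @ \oo --> rho.

Definition weight (T : Type) (R : realType) (S : nat -> T -> R)
    (j : nat) (x : T) : R :=
  expR (- S j x).

(* p is a version of the conditional probability P(E | G) *)
Definition is_cond_prob (d : measure_display) (T : measurableType d)
    (R : realType) (P : probability T R) (G : set_system T) (E : set T)
    (p : T -> R) : Prop :=
  (forall B : set R, measurable B -> G (p @^-1` B)) /\
  (forall A : set T, G A -> P (A `&` E) = (\int[P]_(x in A) (p x)%:E)%E).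

(* The sigma-algebra generated by all the weights w(j), 0 <= j, together with
   the choices star k = k^* made at the steps 1 <= k < n. *)
Definition history (T : Type) (R : realType) (w : nat -> T -> R)
    (star : nat -> T -> nat) (n : nat) : set_system T :=
  <<s [set A | exists j (B : set R), measurable B /\ A = w j @^-1` B] `|`
      [set A | exists k i : nat, (1 <= k < n)%N /\ A = star k @^-1` [set i]] >>.

(* [star n] is the index n^* of the parent of v(n), 1 <= n; [star 0] plays no
   role, since the root has no parent. *)
Definition recursive_tree (d : measure_display) (T : measurableType d)
    (R : realType) (P : probability T R) (w : nat -> T -> R)
    (star : nat -> {RV P >-> nat}) : Prop :=
  forall n : nat, (1 <= n)%N ->
    (forall x, (star n x < n)%N) /\
    (forall i : nat, (i < n)%N ->
       is_cond_prob P (history w star n) (star n @^-1` [set i])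
         (fun x => w i x / \sum_(q < n) w q x)).

(* N_n(j): note the order of the arguments n and j *)
Definition outdegree (T : Type) (R : realType) (star : nat -> T -> nat)
    (n j : nat) (x : T) : R :=
  \sum_(j.+1 <= k < n.+1) (star k x == j)%:R.

(* The filter on pairs (n, j) along which min(j, n - j) tends to infinity. The
   subtraction is truncated, so 1 <= minn j (n - j) forces 1 <= j < n. *)
Definition min_infty : set_system (nat * nat) :=
  filter_from setT
    (fun K : nat => [set nj | (K <= minn nj.2 (nj.1 - nj.2))%N]).

Global Instance min_infty_filter : ProperFilter min_infty.
Proof.
apply: filter_from_proper.
  apply: filter_from_filter; first by exists 0%N.
  move=> K L _ _; exists (maxn K L) => // nj /=.
  by rewrite geq_max => /andP[].
by move=> K _; exists (K + K, K)%N; rewrite /= addnK minnn.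
Qed.

(* Main.v *)
Require Import Defs.
From HB Require Import structures.
From mathcomp Require Import all_boot all_order all_algebra perm.
From mathcomp Require Import finmap.
From mathcomp Require Import all_classical all_reals all_analysis.
From mathcomp Require Import measurable_realfun ring lra zify.

Set Implicit Arguments.
Unset Strict Implicit.
Unset Printing Implicit Defensive.

Import Order.TTheory GRing.Theory Num.Theory.
Import numFieldNormedType.Exports.

Local Open Scope classical_set_scope.
Local Open Scope ring_scope.

(** Let f(j, m) be the mean, for a walk of j + m steps, of the weight of vertex j
    divided by the sum of all weights. The conditional law of the parents shows that
    the mean degree of v(j) after n steps is the sum of f(j, m) over m < n - j.

    The shares of the vertices add up to one, as do the probabilities
    b(j) a(m) that the path of j + m steps is lowest at time j; here b(j)
    and a(m) are the probabilities of the past and of the future of a lowest point,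
    which are the two probabilities in the theorem. The proof compares these two unit
    masses by a transport: a path places its mass at its lowest point i and hands it over
    to each j in proportion to the weight of j ([flow]). The share of j is at most
    exp(-(S_j - S_i)), and the mean of this quantity, restricted to paths which
    stay above S_i, is summable in the distance from i to j ([post_mass_le],
    [post_tilt_bounded]). So in a large rectangle j < J, m < M the mass that
    crosses the boundary is negligible, and the sum of f over the rectangle is
    equivalent to B(J) A(M), where B and A are the partial sums of b
    and a ([transport], [degree_sum_equiv]).

    Spitzer's condition gives m a(m) ~ rho A(m) and j b(j) ~ (1 - rho) B(j).
    Indeed, comparing the lowest points of the first and of the last n steps of a walk of
    n + 1 steps yields Sparre Andersen's theorem ([Elow_pos]), hence the recursion
    n b(n) = sum over i < n of b(i) P(S_(n-i) <= 0) ([renewal_identity]);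
    a summation by parts in this recursion needs the averages of P(S_k <= 0) only
    ([density_ratio]).

    As f(j, m) is nonincreasing in j ([Eshare_noninc]), the sum over the
    rectangle may be differentiated in j ([monotone_density]): the mean degree is
    equivalent to b(j) A(n - j), that is to b(j) (n - j) a(n - j) / rho.

    Ties need care: the probabilities in the theorem use the weak convention and
    Spitzer's condition the strict one. The transport works for both
    conventions, and the sum of f does not depend on the convention, so the products
    B(J) A(M) for the two conventions are equivalent ([prod_sum_equiv]). *)

(** * Measurable functionals of finite words *)

Section word_functionals.
Context {R : realType}.
Implicit Types (g h : seq R -> R) (p : seq R -> bool).

(** A functional of words stands for its restrictions to words of each length,
    so measurability is asked on every space of tuples. *)
Definition wmeas g := forall n, measurable_fun [set: n.-tuple R] (fun y => g y).
Definition wbmeas p := forall n, measurable_fun [set: n.-tuple R] (fun y => p y).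

(** Boundedness on words of a fixed length makes every functional below
    integrable; it is not uniform in the length, so that positions of indices are
    allowed as values. *)
Definition good g :=
  wmeas g /\ forall n, exists c : R, forall y : n.-tuple R, `|g y| <= c.

Lemma wmeas_cst c : wmeas (fun=> c). Proof. by move=> n. Qed.

Lemma wmeasD g h : wmeas g -> wmeas h -> wmeas (fun y => g y + h y).
Proof. by move=> mg mh n; apply: measurable_funD; [exact: mg|exact: mh]. Qed.

Lemma wmeasM g h : wmeas g -> wmeas h -> wmeas (fun y => g y * h y).
Proof. by move=> mg mh n; apply: measurable_funM; [exact: mg|exact: mh]. Qed.

Lemma wmeasN g : wmeas g -> wmeas (fun y => - g y).
Proof. by move=> mg n; apply: measurableT_comp => //; exact: mg. Qed.

Lemma wmeas_expR g : wmeas g -> wmeas (fun y => expR (g y)).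
Proof. by move=> mg n; apply: measurableT_comp => //; exact: mg. Qed.

Lemma wmeas_sum (I : Type) (s : seq I) (F : I -> seq R -> R) :
  (forall i, wmeas (F i)) -> wmeas (fun y => \sum_(i <- s) F i y).
Proof. by move=> mF n; apply: measurable_sum => i; apply: mF. Qed.

Lemma wbmeas_ind p : wbmeas p -> wmeas (fun y => (p y)%:R).
Proof.
by move=> mp n; apply: (@measurableT_comp _ _ _ _ _ _ (fun b : bool => b%:R : R)) => //; exact: mp.
Qed.

Lemma wbmeasN p : wbmeas p -> wbmeas (fun y => ~~ p y).
Proof. by move=> mp n; apply: (@measurableT_comp _ _ _ _ _ _ negb) => //; exact: mp. Qed.

Lemma wbmeas_and p q : wbmeas p -> wbmeas q -> wbmeas (fun y => p y && q y).
Proof. by move=> mp mq n; apply: measurable_and; [exact: mp|exact: mq]. Qed.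

Lemma wbmeas_lt g h : wmeas g -> wmeas h -> wbmeas (fun y => g y < h y).
Proof. by move=> mg mh n; apply: measurable_fun_ltr; [exact: mg|exact: mh]. Qed.

Lemma wbmeas_le g h : wmeas g -> wmeas h -> wbmeas (fun y => g y <= h y).
Proof. by move=> mg mh n; apply: measurable_fun_ler; [exact: mg|exact: mh]. Qed.

Lemma wmeas_nth k : wmeas (fun y => nth 0 y k).
Proof.
move=> n; have [kn|nk] := ltnP k n.
  rewrite [X in measurable_fun _ X](_ : _ = (fun y => tnth y (Ordinal kn))).
    exact: measurable_tnth.
  by apply/funext => y; rewrite (tnth_nth 0).
rewrite [X in measurable_fun _ X](_ : _ = cst 0)//.
by apply/funext => y; rewrite nth_default// size_tuple.
Qed.

Lemma measurable_sel n m (f : n.-tuple R -> m.-tuple R) :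
  (forall i, measurable_fun setT (fun y => nth 0 (f y) i)) ->
  measurable_fun setT f.
Proof.
move=> mf; apply/measurable_fun_tnthP => i.
rewrite [X in measurable_fun _ X](_ : _ = (fun y => nth 0 (f y) i))//.
by apply/funext => y /=; rewrite (tnth_nth 0).
Qed.

Lemma wmeas_comp (phi : seq R -> seq R) (N : nat -> nat) g :
  (forall y, size (phi y) = N (size y)) ->
  (forall i, wmeas (fun y => nth 0 (phi y) i)) ->
  wmeas g -> wmeas (g \o phi).
Proof.
move=> sphi mphi mg n.
have szN (y : n.-tuple R) : size (phi y) == N n by rewrite sphi size_tuple.
pose f (y : n.-tuple R) : (N n).-tuple R := Tuple (szN y).
have mf : measurable_fun setT f by apply: measurable_sel => i; exact: mphi.
exact: measurableT_comp (mg (N n)) mf.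
Qed.

Lemma good_comp (phi : seq R -> seq R) (N : nat -> nat) g :
  (forall y, size (phi y) = N (size y)) ->
  (forall i, wmeas (fun y => nth 0 (phi y) i)) ->
  good g -> good (g \o phi).
Proof.
move=> sphi mphi [mg bg]; split; first exact: (wmeas_comp sphi mphi).
move=> n; have [c gc] := bg (N n); exists c => y.
have szN : size (phi y) == N n by rewrite sphi size_tuple.
exact: (gc (Tuple szN)).
Qed.

Lemma good_ext g h : g =1 h -> good g -> good h.
Proof. by move=> /funext ->. Qed.

Lemma good_cst c : good (fun=> c).
Proof. by split=> [|n]; [exact: wmeas_cst|exists `|c|]. Qed.

Lemma goodD g h : good g -> good h -> good (fun y => g y + h y).
Proof.
move=> [mg bg] [mh bh]; split=> [|n]; first exact: wmeasD.
have [[c gc] [e he]] := (bg n, bh n); exists (c + e) => y.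
by rewrite (le_trans (ler_normD _ _))// lerD.
Qed.

Lemma goodM g h : good g -> good h -> good (fun y => g y * h y).
Proof.
move=> [mg bg] [mh bh]; split=> [|n]; first exact: wmeasM.
have [[c gc] [e he]] := (bg n, bh n); exists (c * e) => y.
by rewrite normrM ler_pM.
Qed.

Lemma good_sum (I : Type) (s : seq I) (F : I -> seq R -> R) :
  (forall i, good (F i)) -> good (fun y => \sum_(i <- s) F i y).
Proof.
move=> gF; elim: s => [|i s IH].
  by apply: good_ext (good_cst 0) => y; rewrite big_nil.
by apply: good_ext (goodD (gF i) IH) => y; rewrite big_cons.
Qed.

Lemma good_bnd g c : wmeas g -> (forall y, `|g y| <= c) -> good g.
Proof. by move=> mg gc; split=> // n; exists c. Qed.

Lemma good_ind p : wbmeas p -> good (fun y => (p y)%:R).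
Proof.
move=> mp; apply: (@good_bnd _ 1); first exact: wbmeas_ind.
by move=> y; case: (p y); rewrite ?normr1 ?normr0.
Qed.

Lemma good_take k g : good g -> good (fun y => g (take k y)).
Proof.
apply: (@good_comp (take k) (minn k)) => [y|i]; first by rewrite size_take_min.
have [ik|ki] := ltnP i k.
  rewrite [X in wmeas X](_ : _ = (fun y => nth 0 y i)); first exact: wmeas_nth.
  by apply/funext => y; rewrite nth_take.
rewrite [X in wmeas X](_ : _ = (fun y => 0)); first exact: wmeas_cst.
by apply/funext => y; rewrite nth_default// size_take_min geq_min ki.
Qed.

Lemma wmeas_nth_drop k i : wmeas (fun y => nth 0 (drop k y) i).
Proof.
rewrite [X in wmeas X](_ : _ = (fun y => nth 0 y (k + i))); first exact: wmeas_nth.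
by apply/funext => y; rewrite nth_drop.
Qed.

Lemma wmeas_drop k g : wmeas g -> wmeas (fun y => g (drop k y)).
Proof.
by apply: (@wmeas_comp (drop k) (subn^~ k)) => [y|i]; [rewrite size_drop|exact: wmeas_nth_drop].
Qed.

Lemma good_drop k g : good g -> good (fun y => g (drop k y)).
Proof.
by apply: (@good_comp (drop k) (subn^~ k)) => [y|i]; [rewrite size_drop|exact: wmeas_nth_drop].
Qed.

(** For a functional whose formula mentions the length of the word, measurability
    may be checked with the length replaced by a constant. *)
Lemma wmeas_fixed g : (forall n, exists2 h, wmeas h &
  forall y : seq R, size y = n -> g y = h y) -> wmeas g.
Proof.
move=> gh n; have [h mh ghE] := gh n.
rewrite [X in measurable_fun _ X](_ : _ = (fun y : n.-tuple R => h y)).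
  exact: mh.
by apply/funext => y; apply: ghE; rewrite size_tuple.
Qed.

Lemma good_opp g : good g -> good (fun y => g (map -%R y)).
Proof.
apply: (@good_comp (map -%R) id) => [y|i]; first by rewrite size_map.
rewrite [X in wmeas X](_ : _ = (fun y => - nth 0 y i)).
  by apply: wmeasN; exact: wmeas_nth.
apply/funext => y; have [iy|iy] := ltnP i (size y); first by rewrite (nth_map 0).
by rewrite !nth_default ?size_map// oppr0.
Qed.

(** All that the argument uses of the law of the increments: [wE n g] is the mean
    of [g] over words of [n] independent increments with a common law. Working with
    this interface makes it possible to reflect the walk. The last two fields are
    the only trace of countable additivity: a step that is positive (negative) with
    positive probability exceeds some margin with positive probability. *)
Record word_law := WordLaw {
  wE :> nat -> (seq R -> R) -> R;
  wE_ext : forall (n : nat) g h, (forall y, size y = n -> g y = h y) -> wE n g = wE n h;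
  wE_cst : forall n c, wE n (fun=> c) = c;
  wED : forall n g h, good g -> good h ->
    wE n (fun y => g y + h y) = wE n g + wE n h;
  wEZ : forall n c g, good g -> wE n (fun y => c * g y) = c * wE n g;
  wE_le : forall n g h, good g -> good h ->
    (forall y, size y = n -> g y <= h y) -> wE n g <= wE n h;
  wE_cat : forall k l g h, good g -> good h ->
    wE (k + l) (fun y => g (take k y) * h (drop k y)) = wE k g * wE l h;
  wE_rot : forall n g, good g -> wE n (fun y => g (rot 1 y)) = wE n g;
  wE_rev : forall n g, good g -> wE n (fun y => g (rev y)) = wE n g;
  wE_up : 0 < wE 1 (fun y => (0 < head 0 y)%R%:R) ->
    exists2 eta, 0 < eta & 0 < wE 1 (fun y => (eta < head 0 y)%R%:R);
  wE_down : 0 < wE 1 (fun y => (0 < - head 0 y)%R%:R) ->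
    exists2 eta, 0 < eta & 0 < wE 1 (fun y => (eta < - head 0 y)%R%:R)
}.

(** Boxes form a pi-system that generates the product sigma-algebra. *)
Lemma tuple_measure_eq n
    (m1 m2 : {measure set (n.-tuple R) -> \bar R}) :
  (m1 setT < +oo)%E ->
  (forall B : nat -> set R, (forall i, measurable (B i)) ->
     m1 [set y | forall i : 'I_n, B i (tnth y i)] =
     m2 [set y | forall i : 'I_n, B i (tnth y i)]) ->
  forall A, measurable A -> m1 A = m2 A.
Proof.
move=> m1oo m12.
pose G : set (set (n.-tuple R)) := [set A | exists2 B : nat -> set R,
  forall i, measurable (B i) & A = [set y | forall i : 'I_n, B i (tnth y i)]].
have Gm : G `<=` measurable.
  move=> _ [B mB ->].
  rewrite [X in measurable X](_ : _ =
     \bigcap_(i in [set: 'I_n]) ((fun y : n.-tuple R => tnth y i) @^-1` B i)).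
    apply: fin_bigcap_measurable => // i _.
    by rewrite -[X in measurable X]setTI; apply: measurable_tnth.
  by apply/seteqP; split => y /= yB i; [move=> _; exact: yB|exact: yB].
have GT : G setT.
  by exists (fun=> setT) => //; apply/seteqP; split.
have GI : setI_closed G.
  move=> _ _ [B mB ->] [C mC ->]; exists (fun i => B i `&` C i).
    by move=> i; apply: measurableI.
  apply/seteqP; split => y /=; first by move=> [yB yC] i; split.
  by move=> yBC; split => i; have [] := yBC i.
move=> A mA; apply: (measure_unique G (fun=> setT)) => //.
- apply/seteqP; split; last first.
    exact: smallest_sub (@sigma_algebra_measurable _ _) Gm.
  apply: smallest_sub; first exact: smallest_sigma_algebra.
  apply: (@big_ind _ (fun S => S `<=` <<s G >>)) => //.
    by move=> S1 S2 H1 H2 C [/H1|/H2].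
  move=> i _ _ [B mB <-]; apply: sub_sigma_algebra.
  exists (fun j => if j == i :> nat then B else setT).
    by move=> j; case: ifP.
  rewrite setTI; apply/seteqP; split => y /=.
    by move=> yB j; case: eqP => // /val_inj ->.
  by move=> /(_ i); rewrite eqxx.
- by apply/seteqP; split => // y _; exists 0%N.
- by move=> _ [B mB ->]; exact: m12.
Qed.

End word_functionals.

(** * The law of the increments of an i.i.d. sequence *)

Section iid_law.
Context d (T : measurableType d) (R : realType) (P : probability T R).
Variable theta : nat -> {RV P >-> R}.

Definition step_word n (x : T) : n.-tuple R := [tuple theta i x | i < n].

Lemma measurable_step_word n : measurable_fun setT (@step_word n).
Proof.
apply/measurable_fun_tnthP => i.
apply: (eq_measurable_fun (theta i : T -> R)) => //.
by move=> x _; rewrite /= tnth_mktuple.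
Qed.

HB.instance Definition _ n :=
  isMeasurableFun.Build _ _ _ _ (@step_word n) (@measurable_step_word n).

Definition step_law n := distribution P (@step_word n).
Arguments step_law : clear implicits.
HB.instance Definition _ n := Probability.on (step_law n).

Definition Ew n (g : seq R -> R) : R := \int[P]_x g (step_word n x).

Lemma step_integrable n g : good g ->
  (step_law n).-integrable setT (fun y : n.-tuple R => (g y)%:E).
Proof.
move=> [mg bg]; have [c gc] := bg n.
apply: measurable_bounded_integrable => //.
- by apply: le_lt_trans (probability_le1 (step_law n) _) _; rewrite ?ltry.
- exact: mg.
- exists c; split; first by rewrite num_real.
  by move=> M cM y _ /=; apply: le_trans (gc _) (ltW cM).
Qed.

Lemma word_integrable n g : good g ->
  P.-integrable setT (fun x => (g (step_word n x))%:E).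
Proof.
move=> [mg bg]; have [c gc] := bg n.
apply: measurable_bounded_integrable => //.
- by apply: le_lt_trans (probability_le1 P _) _; rewrite ?ltry.
- exact: (measurableT_comp (mg n) (@measurable_step_word n)).
- exists c; split; first by rewrite num_real.
  by move=> M cM y _; exact: le_trans (gc (step_word n y)) (ltW cM).
Qed.

Lemma EwE n g : good g ->
  (\int[step_law n]_y (g y)%:E = \int[P]_x (g (step_word n x))%:E)%E.
Proof.
move=> gg; have [mg _] := gg; rewrite /step_law integral_distribution//.
- by apply/measurable_EFinP; exact: mg.
- exact: word_integrable.
Qed.

Lemma Ew_fin n g : good g ->
  ((Ew n g)%:E = \int[P]_x (g (step_word n x))%:E)%E.
Proof.
move=> gg; rewrite /Ew /Rintegral fineK//; apply: integrable_fin_num => //.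
exact: word_integrable.
Qed.

Hypothesis theta_iid : iid theta.

Lemma box_prob n (B : nat -> set R) : (forall i, measurable (B i)) ->
  P [set x | forall i : 'I_n, B i (theta i x)] =
  (\prod_(i < n) P (theta 0 @^-1` B i))%E.
Proof.
move=> mB; have [ind idd] := theta_iid.
have perm_iota : perm_eq [fset i | i in iota 0 n]%fset (iota 0 n).
  apply: uniq_perm; rewrite ?iota_uniq// => i.
  by apply/imfsetP/idP => /= [[j jn ->//]|jn]; exists i.
transitivity (P (\bigcap_(i in [set` [fset i | i in iota 0 n]%fset])
                    (theta i @^-1` B i))).
  congr (P _); apply/seteqP; split => x /=.
    move=> xB i /=; rewrite (perm_mem perm_iota) mem_iota add0n => /andP[_ ni].
    exact: (xB (Ordinal ni)).
  move=> xB i; apply: xB => /=.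
  by rewrite (perm_mem perm_iota) mem_iota add0n leq0n ltn_ord.
rewrite ind// (perm_big _ perm_iota)/= -[X in iota _ X]subn0 big_mkord.
by apply: eq_bigr => i _; exact: idd.
Qed.

Lemma step_law_box n (B : nat -> set R) : (forall i, measurable (B i)) ->
  step_law n [set y | forall i : 'I_n, B i (tnth y i)] =
  (\prod_(i < n) P (theta 0 @^-1` B i))%E.
Proof.
move=> mB; rewrite -box_prob//; congr (P _).
by apply/seteqP; split => x /= xB i; have := xB i; rewrite tnth_mktuple.
Qed.

Lemma measurable_perm n (s : {perm 'I_n}) :
  measurable_fun setT (fun y : n.-tuple R => [tuple tnth y (s i) | i < n]).
Proof.
apply/measurable_fun_tnthP => i.
apply: (eq_measurable_fun (fun y : n.-tuple R => tnth y (s i))).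
  by move=> y _; rewrite /= tnth_mktuple.
exact: measurable_tnth.
Qed.

(** Exchangeability: the two laws agree on boxes, because the product of the
    marginal probabilities of the sides does not depend on their order. *)
Lemma Ew_perm n (s : {perm 'I_n}) (g : seq R -> R) : good g ->
  Ew n (fun y => g [seq nth 0 y (s i) | i <- enum 'I_n]) = Ew n g.
Proof.
move=> gg; pose f (y : n.-tuple R) := [tuple tnth y (s i) | i < n].
have mf : measurable_fun setT f by exact: measurable_perm.
pose fm : {mfun (n.-tuple R) >-> (n.-tuple R)} :=
  HB.pack f (isMeasurableFun.Build _ _ _ _ f mf).
have lawE A : measurable A -> step_law n A = distribution (step_law n) fm A.
  apply: tuple_measure_eq.
    by apply: le_lt_trans (probability_le1 (step_law n) _) _; rewrite ?ltry.
  move=> B mB.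
  transitivity (\prod_(i < n) P (theta 0 @^-1` B i))%E.
    exact: step_law_box.
  pose C j := if insub j is Some i then B (s^-1%g i : 'I_n) else setT.
  have CE (i : 'I_n) : C i = B (s^-1%g i) by rewrite /C valK.
  have mC j : measurable (C j) by rewrite /C; case: insub.
  transitivity (step_law n [set y | forall i : 'I_n, C i (tnth y i)]).
    rewrite [RHS]step_law_box// [RHS](reindex_inj (@perm_inj _ s)) /=.
    by apply: eq_bigr => i _; rewrite CE permK.
  congr (step_law n _); apply/seteqP; split => y /= yB i.
    by have := yB (s i); rewrite CE permK tnth_mktuple.
  by have := yB (s^-1%g i); rewrite CE tnth_mktuple permKV.
rewrite /Ew /Rintegral; congr fine; rewrite -[RHS]EwE//.
rewrite [RHS](_ : _ = \int[distribution (step_law n) fm]_y (g y)%:E)%E; last first.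
  by apply: eq_measure_integral => A mA _; exact: lawE.
have [mg _] := gg; rewrite integral_distribution//; last 2 first.
- by apply/measurable_EFinP; exact: mg.
- have [mg' [c gc]] := (mg n, gg.2 n).
  apply: measurable_bounded_integrable => //.
  + by apply: le_lt_trans (probability_le1 (step_law n) _) _; rewrite ?ltry.
  + exact: (measurableT_comp mg' mf).
  + exists c; split; first by rewrite num_real.
    by move=> M cM y _; exact: le_trans (gc (f y)) (ltW cM).
rewrite -[LHS]/(\int[P]_x _)%E.
have gf : good (fun y : seq R => g [seq nth 0 y (s i) | i <- enum 'I_n]).
  apply: (@good_comp _ (fun y => [seq nth 0 y (s i) | i <- enum 'I_n]) (fun=> n)) gg.
    by move=> y; rewrite size_map size_enum_ord.
  move=> i; have [ni|ni] := ltnP i n.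
    rewrite [X in wmeas X](_ : _ = (fun y => nth 0 y (s (Ordinal ni)))).
      exact: wmeas_nth.
    apply/funext => y; rewrite (nth_map (Ordinal ni)) ?size_enum_ord//.
    by rewrite (nth_ord_enum _ (Ordinal ni)).
  rewrite [X in wmeas X](_ : _ = (fun=> 0)); first exact: wmeas_cst.
  by apply/funext => y; rewrite nth_default// size_map size_enum_ord.
rewrite -(EwE n gf); apply: eq_integral => y _ /=.
congr (g _)%:E; apply: eq_map => i; by rewrite (tnth_nth 0).
Qed.

Lemma Ew_rev n (g : seq R -> R) : good g -> Ew n (fun y => g (rev y)) = Ew n g.
Proof.
move=> gg; rewrite -(Ew_perm (perm (@rev_ord_inj n)) gg).
apply: eq_Rintegral => x _; congr g.
apply: (@eq_from_nth _ 0); first by rewrite size_rev size_tuple size_map size_enum_ord.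
move=> i; rewrite size_rev size_tuple => ni.
rewrite nth_rev ?size_tuple// [RHS](nth_map (Ordinal ni)) ?size_enum_ord//.
by rewrite (nth_ord_enum _ (Ordinal ni)) permE.
Qed.

Lemma Ew_rot n (g : seq R -> R) : good g -> Ew n (fun y => g (rot 1 y)) = Ew n g.
Proof.
move=> gg; rewrite -(Ew_perm (perm (@ordS_inj n)) gg).
apply: eq_Rintegral => x _; congr g.
apply: (@eq_from_nth _ 0); first by rewrite size_rot size_tuple size_map size_enum_ord.
move=> i; rewrite size_rot size_tuple => ni.
rewrite [RHS](nth_map (Ordinal ni)) ?size_enum_ord// (nth_ord_enum _ (Ordinal ni)) permE.
case: (step_word n x) => -[|y s] /= /eqP yn; first by rewrite -yn in ni.
rewrite rot1_cons nth_rcons; move: ni; rewrite -yn /= ltnS leq_eqVlt => /predU1P[->|ni].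
  by rewrite ltnn eqxx modnn.
by rewrite ni modn_small// ltnS.
Qed.

Lemma measurable_cat k l :
  measurable_fun setT
    (fun z : k.-tuple R * l.-tuple R => [tuple of z.1 ++ z.2]).
Proof.
apply/measurable_fun_tnthP => i; have [j ij|j ij] := split_ordP i.
  apply: (eq_measurable_fun (fun z : k.-tuple R * l.-tuple R => tnth z.1 j)).
    by move=> z _; rewrite /= ij tnth_lshift.
  exact: measurableT_comp (measurable_tnth j) measurable_fst.
apply: (eq_measurable_fun (fun z : k.-tuple R * l.-tuple R => tnth z.2 j)).
  by move=> z _; rewrite /= ij tnth_rshift.
exact: measurableT_comp (measurable_tnth j) measurable_snd.
Qed.

(** On boxes, the law of a concatenation of two independent blocks is the law of
    the long word; Fubini then splits the integral of a product. *)
Lemma Ew_cat k l (g h : seq R -> R) : good g -> good h ->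
  Ew (k + l) (fun y => g (take k y) * h (drop k y)) = Ew k g * Ew l h.
Proof.
move=> gg gh.
pose f (z : k.-tuple R * l.-tuple R) := [tuple of z.1 ++ z.2].
have mf : measurable_fun setT f by exact: measurable_cat.
pose fm : {mfun (k.-tuple R * l.-tuple R)%type >-> ((k + l).-tuple R)} :=
  HB.pack f (isMeasurableFun.Build _ _ _ _ f mf).
pose Q := (step_law k \x step_law l)%E.
have lawE A : measurable A -> step_law (k + l) A = pushforward Q fm A.
  apply: tuple_measure_eq.
    by apply: le_lt_trans (probability_le1 (step_law _) _) _; rewrite ?ltry.
  move=> B mB.
  transitivity (\prod_(i < k + l) P (theta 0 @^-1` B i))%E.
    exact: step_law_box.
  transitivity (Q ([set u : k.-tuple R | forall i : 'I_k, B i (tnth u i)] `*`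
      [set v : l.-tuple R | forall i : 'I_l, B (k + i)%N (tnth v i)])); last first.
    congr (Q _); apply/seteqP; split => [[u v] /= [uB vB] i|[u v] /= uvB]; last first.
      split=> i; first by have := uvB (lshift l i); rewrite tnth_lshift.
      by have := uvB (rshift k i); rewrite tnth_rshift.
    have [j ->|j ->] := split_ordP i; first by rewrite tnth_lshift; exact: uB.
    by rewrite tnth_rshift; exact: vB.
  have mbox n (C : nat -> set R) : (forall i, measurable (C i)) ->
      measurable [set u : n.-tuple R | forall i : 'I_n, C i (tnth u i)].
    move=> mC; rewrite [X in measurable X](_ : _ =
       \bigcap_(i in [set: 'I_n]) ((fun y : n.-tuple R => tnth y i) @^-1` C i)).
      apply: fin_bigcap_measurable => // i _.
      by rewrite -[X in measurable X]setTI; apply: measurable_tnth.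
    by apply/seteqP; split => y /= yB i; [move=> _; exact: yB|exact: yB].
  have mB1 := mbox k B mB; have mB2 := mbox l (fun i => B (k + i)%N) (fun i => mB _).
  transitivity (step_law k [set u | forall i : 'I_k, B i (tnth u i)] *
    step_law l [set v | forall i : 'I_l, B (k + i)%N (tnth v i)])%E; last first.
    by symmetry; exact: product_measure1E.
  rewrite big_split_ord /=; congr (_ * _)%E; symmetry; first exact: step_law_box.
  exact: (@step_law_box l (fun i => B (k + i)%N)).
pose G (y : seq R) := g (take k y) * h (drop k y).
have gG : good G by apply: goodM; [exact: good_take|exact: good_drop].
have GfE z : G (f z) = g z.1 * h z.2.
  by rewrite /G /f /= take_size_cat ?size_tuple// drop_size_cat ?size_tuple.
have QT : Q setT = 1%E.
  transitivity (Q (setT `*` setT)); first by rewrite setXTT.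
  transitivity (step_law k setT * step_law l setT)%E.
    exact: product_measure1E.
  have E1 n : step_law n setT = 1%E by exact: probability_setT.
  by rewrite !E1 mule1.
have Gint : Q.-integrable setT (fun z => (G (f z))%:E).
  have [mG [c Gc]] := (gG.1 (k + l)%N, gG.2 (k + l)%N).
  apply: measurable_bounded_integrable => //.
  + by rewrite [X in (X < _)%E]QT ltry.
  + exact: (measurableT_comp mG mf).
  + exists c; split; first by rewrite num_real.
    by move=> M cM y _; exact: le_trans (Gc (f y)) (ltW cM).
rewrite /Ew /Rintegral.
rewrite [X in fine X = _](_ : _ = \int[pushforward Q fm]_y (G y)%:E)%E; last first.
  rewrite -(EwE (k + l) gG).
  by apply: eq_measure_integral => A mA _; exact: lawE.
rewrite integral_pushforward//; last by apply/measurable_EFinP; exact: gG.1.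
rewrite preimage_setT -integral12_prod_meas1//.
rewrite (eq_integral (fun u : k.-tuple R => (Ew l h)%:E * (g u)%:E)%E); last first.
  move=> u _; rewrite /fubini_F /=.
  rewrite (eq_integral (fun v : l.-tuple R => (g u)%:E * (h v)%:E)%E); last first.
    by move=> v _; rewrite -EFinM -(GfE (u, v)).
  rewrite integralZl; [|exact: measurableT|exact: step_integrable].
  by rewrite EwE// -Ew_fin// muleC.
rewrite integralZl//; last exact: step_integrable.
by rewrite EwE// -!Ew_fin//= mulrC.
Qed.

Lemma Ew_cst n c : Ew n (fun=> c) = c.
Proof.
rewrite /Ew Rintegral_cst// [fine _](_ : _ = 1) ?mulr1//.
by rewrite -[RHS]/(fine 1%E); congr fine; exact: probability_setT.
Qed.

Lemma EwD n (g h : seq R -> R) : good g -> good h ->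
  Ew n (fun y => g y + h y) = Ew n g + Ew n h.
Proof.
by move=> gg gh; apply: RintegralD; [exact: measurableT|exact: word_integrable..].
Qed.

Lemma EwZ n c (g : seq R -> R) : good g -> Ew n (fun y => c * g y) = c * Ew n g.
Proof. by move=> gg; apply: RintegralZl; [exact: measurableT|exact: word_integrable]. Qed.

Lemma Ew_le n (g h : seq R -> R) : good g -> good h ->
  (forall y, size y = n -> g y <= h y) -> Ew n g <= Ew n h.
Proof.
move=> gg gh gleh; apply: le_Rintegral; [exact: measurableT|exact: word_integrable..|].
by move=> x _; apply: gleh; rewrite size_tuple.
Qed.

Lemma Ew_ext n (g h : seq R -> R) : (forall y, size y = n -> g y = h y) ->
  Ew n g = Ew n h.
Proof. by move=> gh; apply: eq_Rintegral => x _; rewrite gh// size_tuple. Qed.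

Lemma Ew_ind n (p : seq R -> bool) : wbmeas p ->
  Ew n (fun y => (p y)%:R) = fine (P [set x | p (step_word n x)]).
Proof.
move=> mp.
have mA : measurable [set x | p (step_word n x)].
  rewrite -[X in measurable X]setTI.
  by apply: (measurableT_comp (mp n) (@measurable_step_word n)) => //.
rewrite /Ew /Rintegral; congr fine.
have := integral_indic P measurableT mA; rewrite setIT => <-.
apply: eq_integral => x _; congr (_%:E); rewrite indicE /=.
by case: (p _) / idP => px; [rewrite mem_set|rewrite memNset].
Qed.

Lemma step_word1 x : tval (step_word 1 x) = [:: theta 0 x].
Proof. by rewrite /= enum_ordSl enum_ord0. Qed.

(** The event that [f] is positive at the first step is a countable union of events
    with a margin, and these cannot all be negligible. *)
Lemma Ew_margin (f : R -> R) : measurable_fun setT f ->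
  0 < Ew 1 (fun y => (0 < f (head 0 y))%R%:R) ->
  exists2 eta, 0 < eta & 0 < Ew 1 (fun y => (eta < f (head 0 y))%R%:R).
Proof.
move=> mf.
have mp c : wbmeas (fun y => c < f (head 0 y)).
  apply: wbmeas_lt; first exact: wmeas_cst.
  move=> n; apply: measurableT_comp => //.
  by under eq_fun => y do rewrite -nth0; exact: (wmeas_nth 0).
rewrite Ew_ind// => pos.
pose F n := [set x | n.+1%:R^-1 < f (theta 0 x)].
have FE c : [set x | c < f (head 0 (step_word 1 x))] = [set x | c < f (theta 0 x)].
  by apply/funext => x /=; rewrite step_word1.
rewrite FE in pos; apply: contrapT => none.
have mF n : measurable (F n).
  rewrite -[X in measurable X]setTI.
  apply: (measurable_fun_ltr (measurable_cst _) (measurableT_comp mf _)) => //.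
have PF0 n : P (F n) = 0.
  apply/eqP; rewrite eq_le measure_ge0 andbT leNgt; apply/negP => Fpos.
  apply: none; exists n.+1%:R^-1; first by rewrite invr_gt0 ltr0n.
  rewrite Ew_ind// FE -/(F n); apply: fine_gt0; rewrite Fpos/=.
  by apply: le_lt_trans (probability_le1 P _) _; rewrite ?ltry.
have F_cover : [set x | 0 < f (theta 0 x)] `<=` \bigcup_n F n.
  move=> x /= fx; have [N _ HN] := near_infty_natSinv_lt (PosNum fx).
  by exists N => //; exact: (HN N (leqnn N)).
move: pos; rewrite (_ : P _ = 0%E) ?ltxx//.
apply: measure_negligible.
  rewrite -[X in measurable X]setTI.
  exact: (measurable_fun_ltr (measurable_cst _) (measurableT_comp mf _)).
apply: negligibleS F_cover _; apply: negligible_bigcup => n.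
by apply/negligibleP; [exact: mF|exact: PF0].
Qed.

Lemma measurable_oppr : measurable_fun [set: R] (-%R : R -> R).
Proof. exact: measurableT_comp (measurable_funN (@measurable_id _ _ _)) _. Qed.

Definition iid_word_law : @word_law R := WordLaw Ew_ext Ew_cst EwD EwZ Ew_le
  Ew_cat Ew_rot Ew_rev (Ew_margin (@measurable_id _ _ _))
  (Ew_margin measurable_oppr).

End iid_law.

(** * Lowest points of paths and words *)

Section half_lines.
Context {R : realType}.
Implicit Types (s : bool) (x z : R).

(** The two conventions for ties, strict for [s = true] and weak for
    [s = false]. In both cases the half-line and its complement are closed under
    addition, which is all that the combinatorics of paths needs, and [posN] shows
    that reflection exchanges the two conventions. *)
Definition pos s x : bool := if s then 0 < x else 0 <= x.

Lemma pos_ge0 s x : pos s x -> 0 <= x.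
Proof. by case: s => //; exact: ltW. Qed.

Lemma npos_le0 s x : ~~ pos s x -> x <= 0.
Proof. by case: s; rewrite /= -?leNgt// -ltNge => /ltW. Qed.

Lemma posD s x z : pos s x -> pos s z -> pos s (x + z).
Proof. by case: s => /=; [exact: addr_gt0|exact: addr_ge0]. Qed.

Lemma nposD s x z : ~~ pos s x -> ~~ pos s z -> ~~ pos s (x + z).
Proof. by case: s => /=; rewrite -?leNgt -?ltNge => hx hz; lra. Qed.

Lemma posN s x : pos (~~ s) (- x) = ~~ pos s x.
Proof. by case: s; rewrite /= ?oppr_ge0 ?oppr_gt0 -?leNgt// -ltNge. Qed.

End half_lines.

Section paths.
Context {R : realType}.
Implicit Types (s : bool) (S : nat -> R) (y : seq R).

(** Time [i] is the lowest point of the path on [0, n], where the last minimum wins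
    in the strict convention and the first one in the weak convention. *)
Definition lowest s S n i : Prop :=
  (forall q, (q < i)%N -> ~~ pos s (S i - S q)) /\
  (forall q, (i < q <= n)%N -> pos s (S q - S i)).

(** Between two lowest points the increment of the path would lie in the half-line
    and in its complement. *)
Lemma lowest_uniq s S n i j : (i <= n)%N -> (j <= n)%N ->
  lowest s S n i -> lowest s S n j -> i = j.
Proof.
move=> + + [bi ai] [bj aj].
wlog ij : i j bi ai bj aj / (i <= j)%N.
  move=> H; have [ij|/ltnW ji] := leqP i j; first exact: H.
  by move=> in_ jn; apply/esym/H.
move=> _ jn; case: (ltngtP i j) ij => // ij _.
by have := bj _ ij; rewrite ai// ij.
Qed.

(** When a point is appended, either the current lowest point survives or the new
    point takes its place; closure under addition compares the new point with the
    points before and after the current one. *)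
Lemma lowest_exists s S n : exists2 i, (i <= n)%N & lowest s S n i.
Proof.
elim: n => [|n [i in_ [bi ai]]].
  by exists 0%N => //; split=> // q; case: q.
have [posi|nposi] := boolP (pos s (S n.+1 - S i)).
  exists i; first exact: leqW.
  split=> // q /andP[iq]; rewrite leq_eqVlt ltnS => /predU1P[->//|qn].
  by apply: ai; rewrite iq.
exists n.+1 => //; split=> q; last by move=> /andP[/leq_trans H /H]; rewrite ltnn.
rewrite ltnS => qn; have [qi|iq|->//] := ltngtP q i.
  by rewrite -(subrK (S i) (S n.+1)) -addrA nposD// bi.
apply/negP => posq; move: nposi.
by rewrite -(subrK (S q) (S n.+1)) -addrA posD// ai// iq.
Qed.

(** If the total increment lies in the half-line, the last point loses against the first one
    and can be dropped without changing the lowest point. *)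
Lemma lowest_drop_last s S n i : pos s (S n.+1 - S 0%N) ->
  ((i <= n.+1)%N /\ lowest s S n.+1 i) <-> ((i <= n)%N /\ lowest s S n i).
Proof.
move=> posn; split=> [[in_ [bi ai]]|[in_ [bi ai]]].
  have i_n : i != n.+1.
    by apply/eqP => i_n; have := bi 0%N; rewrite i_n posn => /(_ isT).
  rewrite leq_eqVlt (negPf i_n) ltnS /= in in_.
  by split=> //; split=> // q /andP[iq qn]; apply: ai; rewrite iq leqW.
split; first exact: leqW.
split=> // q /andP[iq]; rewrite leq_eqVlt ltnS => /predU1P[->|qn]; last first.
  by apply: ai; rewrite iq.
case: i => [//|i] in bi {ai iq in_} *.
apply: contraT => nposi; move: posn; rewrite -(subrK (S i.+1) (S n.+1)) -addrA.
by rewrite (negPf (nposD nposi (bi 0%N isT))).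
Qed.

(** If the total increment is outside the half-line, the first point loses against the last
    one, so the lowest point is that of the path started one step later. *)
Lemma lowest_drop_first s S n i : ~~ pos s (S n.+1 - S 0%N) ->
  ((i <= n.+1)%N /\ lowest s S n.+1 i) <->
  (exists2 j, i = j.+1 & (j <= n)%N /\ lowest s (S \o succn) n j).
Proof.
move=> nposn; split=> [[in_ [bi ai]]|[j -> [jn [bj aj]]]].
  case: i => [|i] in in_ bi ai *.
    by have := ai n.+1; rewrite (negPf nposn) ltnS leqnn => /(_ isT).
  exists i => //; split=> //; split=> q qi; first exact: (bi q.+1).
  exact: (ai q.+1).
split=> //; split=> [[_|q]|[//|q]]; [|exact: bj|exact: aj].
apply/negP => posj; move: nposn; have [jn'|nj] := ltnP j n.
  rewrite -(subrK (S j.+1) (S n.+1)) -addrA posD// aj// jn'; exact: leqnn.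
by rewrite (_ : n = j) ?posj//; apply/eqP; rewrite eqn_leq nj jn.
Qed.

Lemma lowest_reverse s S S' c n i : (i <= n)%N ->
  (forall q, (q <= n)%N -> S' q = S (n - q)%N - c) ->
  lowest s S n i -> lowest (~~ s) S' n (n - i).
Proof.
move=> in_ S'E [bi ai]; split=> q qn.
  have qn' : (q <= n)%N by lia.
  rewrite !S'E ?leq_subr// subKn//.
  rewrite (_ : _ - c - _ = - (S (n - q)%N - S i)); last by ring.
  by rewrite posN negbK ai//; lia.
have qn' : (q <= n)%N by lia.
have qn'' : (q <= n)%N by lia.
rewrite !S'E ?leq_subr// subKn//.
rewrite (_ : _ - c - _ = - (S i - S (n - q)%N)); last by ring.
by rewrite posN bi//; lia.
Qed.

End paths.

Section words.
Context {R : realType}.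
Implicit Types (s : bool) (y : seq R).

Definition wsum y : R := \sum_(x <- y) x.
Definition psum y k : R := wsum (take k y).

Lemma psum0 y : psum y 0 = 0. Proof. by rewrite /psum take0 /wsum big_nil. Qed.

Lemma psum_size y : psum y (size y) = wsum y.
Proof. by rewrite /psum take_size. Qed.

Lemma wsum_cat y z : wsum (y ++ z) = wsum y + wsum z.
Proof. by rewrite /wsum big_cat. Qed.

Lemma psum_take y k q : (q <= k)%N -> psum (take k y) q = psum y q.
Proof. by move=> qk; rewrite /psum take_takel. Qed.

Lemma psum_drop y k q : psum (drop k y) q = psum y (k + q) - psum y k.
Proof. by rewrite /psum takeD wsum_cat addrAC subrr add0r. Qed.

Lemma wsum_drop y k : wsum (drop k y) = wsum y - psum y k.
Proof. by rewrite -[in wsum y](cat_take_drop k y) wsum_cat /psum addrAC subrr add0r. Qed.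

Lemma psum_behead y k : psum (behead y) k = psum y k.+1 - psum y 1.
Proof. by rewrite -drop1 psum_drop add1n. Qed.

Lemma psumE y k : psum y k = \sum_(i < k) nth 0 y i.
Proof.
rewrite /psum /wsum; elim: k y => [|k IH] [|x y]; rewrite ?big_nil ?big_ord0//.
  by rewrite big1// => i _; rewrite nth_nil.
by rewrite /= big_cons big_ord_recl /= IH.
Qed.

(** The word of increments of a path that starts from its lowest point. *)
Definition post s y := all (fun k => pos s (psum y k.+1)) (iota 0 (size y)).

(** The word of increments of a path that ends at its lowest point. *)
Definition pre s y := all (fun k => ~~ pos s (wsum (drop k y))) (iota 0 (size y)).
Definition lowest_at s i y := pre s (take i y) && post s (drop i y).

Lemma postP s y :
  reflect (forall k, (0 < k <= size y)%N -> pos s (psum y k)) (post s y).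
Proof.
apply: (iffP allP) => H k.
  by case: k => // k ky; apply: H; rewrite mem_iota.
by rewrite mem_iota => /andP[_ ky]; apply: H.
Qed.

Lemma preP s y :
  reflect (forall k, (k < size y)%N -> ~~ pos s (wsum y - psum y k)) (pre s y).
Proof.
apply: (iffP allP) => H k.
  by move=> ky; rewrite -wsum_drop; apply: H; rewrite mem_iota.
by rewrite mem_iota wsum_drop => /andP[_ ky]; apply: H.
Qed.

(** Being lowest at time [i] is a condition on the past and a condition on the
    future, and these concern disjoint blocks of increments. *)
Lemma lowest_atP s i y : (i <= size y)%N ->
  reflect (lowest s (psum y) (size y) i) (lowest_at s i y).
Proof.
move=> iy; apply: (iffP andP) => -[].
  move=> /preP bi /postP ai; split=> q.
    move=> qi; have := bi q; rewrite size_takel// qi psum_take ?(ltnW qi)//.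
    by rewrite -/(psum y i); apply.
  move=> /andP[iq qy]; have := ai (q - i)%N; rewrite size_drop psum_drop.
  by rewrite subnKC ?(ltnW iq)//; apply; lia.
move=> bi ai; split; [apply/preP|apply/postP] => k.
  rewrite size_takel// => ki; rewrite psum_take ?(ltnW ki)//; exact: bi.
rewrite size_drop psum_drop => kyi; apply: ai; lia.
Qed.

Lemma lowest_at0 s y : lowest_at s 0 y = post s y.
Proof. by rewrite /lowest_at take0 drop0. Qed.

Lemma lowest_at_size s y : lowest_at s (size y) y = pre s y.
Proof. by rewrite /lowest_at take_size drop_size andbT. Qed.

Lemma lowest_at_one s y : \sum_(i < (size y).+1) (lowest_at s i y)%:R = 1 :> R.
Proof.
have [i in_ li] := lowest_exists s (psum y) (size y).
rewrite (bigD1 (Ordinal (in_ : i < (size y).+1)%N))//=.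
rewrite (introT (lowest_atP _ in_) li) big1 ?addr0// => j ji.
case: (boolP (lowest_at s j y)) => // /lowest_atP lj; exfalso; move/eqP: ji; apply.
have jn : (j <= size y)%N by rewrite -ltnS.
by apply/val_inj => /=; apply: lowest_uniq (lj jn) li.
Qed.

(** Time of the lowest point, written as a sum so that its mean is read off from the
    probabilities of [lowest_at]. *)
Definition low_pos s y : R := \sum_(i < (size y).+1) i%:R * (lowest_at s i y)%:R.

Lemma low_pos_take s y n : size y = n.+1 -> pos s (wsum y) ->
  low_pos s y = low_pos s (take n y).
Proof.
move=> yn posy; have ty : size (take n y) = n by rewrite size_takel// yn.
have posn : pos s (psum y n.+1 - psum y 0) by rewrite psum0 subr0 -yn psum_size.
have eqv (i : nat) : (i <= n)%N -> lowest_at s i y = lowest_at s i (take n y).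
  move=> in_; have in1 : (i <= size y)%N by rewrite yn leqW.
  have in2 : (i <= size (take n y))%N by rewrite ty.
  have lE : lowest s (psum (take n y)) n i <-> lowest s (psum y) n i.
    by split=> -[bi ai]; split=> q qn; [have := bi _ qn|have := ai _ qn|
      have := bi _ qn|have := ai _ qn]; rewrite !psum_take//; lia.
  apply/(lowest_atP s in1)/(lowest_atP s in2); rewrite yn ty lE => l.
    by have [/(_ (conj (leqW in_) l))[]] := lowest_drop_last i posn.
  by have [_ /(_ (conj in_ l))[]] := lowest_drop_last i posn.
rewrite /low_pos yn ty big_ord_recr /= (_ : lowest_at s n.+1 y = false) ?mulr0 ?addr0.
  by apply: eq_bigr => i _; rewrite eqv// -ltnS.
apply/negP; rewrite -yn => /(lowest_atP s (leqnn _)); rewrite yn => l.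
by have [/(_ (conj (leqnn _) l))[]] := lowest_drop_last n.+1 posn; rewrite ltnn.
Qed.

Lemma low_pos_behead s y n : size y = n.+1 -> ~~ pos s (wsum y) ->
  low_pos s y = 1 + low_pos s (behead y).
Proof.
move=> yn nposy; have by_ : size (behead y) = n by rewrite size_behead yn.
have nposn : ~~ pos s (psum y n.+1 - psum y 0) by rewrite psum0 subr0 -yn psum_size.
have eqv (i : nat) : (i <= n)%N -> lowest_at s i.+1 y = lowest_at s i (behead y).
  move=> in_; have in1 : (i < size y)%N by rewrite yn ltnS.
  have in2 : (i <= size (behead y))%N by rewrite by_.
  have lE : lowest s (psum (behead y)) n i <-> lowest s (psum y \o succn) n i.
    by split=> -[bi ai]; split=> q qn; [have := bi _ qn|have := ai _ qn|
      have := bi _ qn|have := ai _ qn];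
      rewrite /= !psum_behead opprB addrA subrK.
  apply/(lowest_atP s in1)/(lowest_atP s in2); rewrite yn by_ lE => l.
    by have [/(_ (conj _ l))] := lowest_drop_first i.+1 nposn; rewrite ltnS =>
      /(_ in_)[j [->] []].
  by have [_ H] := lowest_drop_first i.+1 nposn; have [] := H (ex_intro2 _ _ i erefl (conj in_ l)).
rewrite /low_pos yn by_ -[X in X + _](lowest_at_one s (behead y)) by_ -big_split /=.
rewrite big_ord_recl /= mul0r add0r; apply: eq_bigr => i _.
rewrite /bump leq0n add1n eqv; last by rewrite -ltnS.
by rewrite -natr1 mulrDl mul1r addrC.
Qed.

End words.

(** * Weight shares, reflection and measurability *)

Section weights.
Context {R : realType}.
Implicit Types (s : bool) (y : seq R).

(** Conditional probability that the next vertex is attached to [v(j)], given the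
    increments of the walk so far. *)
Definition share j y : R :=
  expR (- psum y j) / \sum_(q < (size y).+1) expR (- psum y q).

Lemma share_den_gt0 y : 0 < \sum_(q < (size y).+1) expR (- psum y q).
Proof.
rewrite big_ord_recl ltr_pwDl ?expR_gt0// sumr_ge0// => q _; exact: expR_ge0.
Qed.

Lemma share_ge0 j y : 0 <= share j y.
Proof. by rewrite divr_ge0 ?expR_ge0// ltW// share_den_gt0. Qed.

Lemma share_sum1 y : \sum_(j < (size y).+1) share j y = 1.
Proof. by rewrite -mulr_suml divff// gt_eqF// share_den_gt0. Qed.

(** The denominator contains the weight of time [i]. With [i] the lowest point this
    makes the share exponentially small in the height of the path above it. *)
Lemma share_le i j y : (i <= size y)%N -> share j y <= expR (psum y i - psum y j).
Proof.
move=> iy; rewrite ler_pdivrMr ?share_den_gt0//.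
rewrite [leLHS](_ : _ = expR (psum y i - psum y j) * expR (- psum y i)); last first.
  by rewrite -expRD; congr expR; ring.
rewrite ler_wpM2l ?expR_ge0// (bigD1 (Ordinal (iy : i < (size y).+1)%N))//=.
by rewrite lerDl sumr_ge0// => q _; exact: expR_ge0.
Qed.

Lemma share_le1 j y : (j <= size y)%N -> share j y <= 1.
Proof. by move=> jy; apply: le_trans (share_le j jy) _; rewrite subrr expR0. Qed.

Lemma psum_oversize y k : (size y <= k)%N -> psum y k = wsum y.
Proof. by move=> yk; rewrite /psum take_oversize. Qed.

Lemma post_psum_ge0 s y k : post s y -> 0 <= psum y k.
Proof.
move=> /postP py; have [ky|yk] := leqP k (size y).
  case: k ky => [|k] ky; first by rewrite psum0.
  by apply: (@pos_ge0 _ s); apply: py; rewrite ltnS ky.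
rewrite psum_oversize ?(ltnW yk)// -psum_size.
case: (size y) py => [|n] py; first by rewrite psum0.
by apply: (@pos_ge0 _ s); apply: py; rewrite ltn0Sn leqnn.
Qed.

Lemma pre_wsum_le0 s y k : pre s y -> wsum y - psum y k <= 0.
Proof.
move=> /preP py; have [yk|ky] := leqP (size y) k; last by apply: (@npos_le0 _ s); exact: py.
by rewrite psum_oversize// subrr.
Qed.

(** Forgetting the oldest vertex can only increase the share of the others. *)
Lemma share_behead j y : (0 < size y)%N -> share j.+1 y <= share j (behead y).
Proof.
case: y => // x y _.
have E q : expR (- psum (x :: y) q.+1) = expR (- x) * expR (- psum y q).
  by rewrite /psum /wsum /= big_cons opprD expRD.
have DE : \sum_(q < (size (x :: y)).+1) expR (- psum (x :: y) q) =
    1 + expR (- x) * \sum_(q < (size y).+1) expR (- psum y q).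
  rewrite big_ord_recl psum0 oppr0 expR0 mulr_sumr; congr (_ + _).
  by apply: eq_bigr => i _; rewrite lift0 E.
have S0 := share_den_gt0 y; rewrite /share DE E [behead _]/=.
set Sy := \sum_(i < _) _ in S0 *.
have Dpos : 0 < 1 + expR (- x) * Sy.
  by rewrite ltr_pwDl// mulr_ge0 ?expR_ge0// ltW.
rewrite ler_pdivrMr// mulrAC ler_pdivlMr// -subr_ge0.
rewrite [leRHS](_ : _ = expR (- psum y j)) ?expR_ge0//; ring.
Qed.

(** Time reversal seen from the end of the path: the mirrored path has the same
    heights in the opposite order, up to a constant. Hence shares and lowest
    points are carried along, and past and future exchange their roles. *)
Definition mirror_word y := rev (map -%R y).

Lemma size_mir y : size (mirror_word y) = size y.
Proof. by rewrite size_rev size_map. Qed.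

Lemma wsum_rev y : wsum (rev y) = wsum y.
Proof. by rewrite /wsum; apply: perm_big; rewrite perm_rev. Qed.

Lemma wsum_opp y : wsum (map -%R y) = - wsum y.
Proof. by rewrite /wsum big_map sumrN. Qed.

Lemma wsum_mir y : wsum (mirror_word y) = - wsum y.
Proof. by rewrite /mirror_word wsum_rev wsum_opp. Qed.

Lemma psum_mir y k : (k <= size y)%N ->
  psum (mirror_word y) k = psum y (size y - k) - wsum y.
Proof.
move=> ky; rewrite /psum /mirror_word take_rev size_map wsum_rev -map_drop wsum_opp.
by rewrite wsum_drop opprB.
Qed.

Lemma lowest_at_mir s i y : (i <= size y)%N ->
  lowest_at (~~ s) (size y - i) (mirror_word y) = lowest_at s i y.
Proof.
move=> iy; have iy' : (size y - i <= size (mirror_word y))%N by rewrite size_mir leq_subr.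
have H := fun q => @psum_mir y q.
apply/(lowest_atP _ iy')/(lowest_atP _ iy); rewrite size_mir.
  move=> l; have := @lowest_reverse _ (~~ s) (psum (mirror_word y)) (psum y) (- wsum y) (size y)
    (size y - i) (leq_subr _ _).
  rewrite negbK subKn//; apply=> // q qy.
  by rewrite H ?leq_subr// subKn// opprK subrK.
by move=> l; apply: (lowest_reverse (S := psum y) (c := wsum y)) => // q; exact: psum_mir.
Qed.

Lemma post_mir s y : post (~~ s) (mirror_word y) = pre s y.
Proof. by rewrite -lowest_at0 -lowest_at_size -(lowest_at_mir s (leqnn _)) subnn. Qed.

Lemma pre_mir s y : pre (~~ s) (mirror_word y) = post s y.
Proof. by rewrite -lowest_at0 -lowest_at_size -(lowest_at_mir s (leq0n _)) subn0 size_mir. Qed.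

Lemma share_mir i y : (i <= size y)%N -> share (size y - i) (mirror_word y) = share i y.
Proof.
move=> iy; rewrite /share size_mir psum_mir ?leq_subr// subKn// opprB expRD.
rewrite [X in _ / X](_ : _ =
    expR (wsum y) * \sum_(q < (size y).+1) expR (- psum y q)); last first.
  rewrite mulr_sumr [RHS](reindex_inj rev_ord_inj)/=; apply: eq_bigr => q _.
  by rewrite psum_mir; [rewrite subSS -expRD opprB|rewrite -ltnS].
by rewrite invfM mulrACA divff ?mul1r// gt_eqF// expR_gt0.
Qed.

Lemma wmeas_psum k : wmeas (fun y : seq R => psum y k).
Proof.
rewrite [X in wmeas X](_ : _ = (fun y : seq R => \sum_(i < k) nth 0 y i)).
  by apply: wmeas_sum => i; exact: wmeas_nth.
by apply/funext => y; rewrite psumE.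
Qed.

Lemma wmeas_wsum : wmeas (@wsum R).
Proof.
apply: wmeas_fixed => n; exists (fun y => psum y n); first exact: wmeas_psum.
by move=> y <-; rewrite psum_size.
Qed.

Lemma wbmeas_fixed (p : seq R -> bool) : (forall n, exists2 q, wbmeas q &
  forall y : seq R, size y = n -> p y = q y) -> wbmeas p.
Proof.
move=> pq n; have [q mq pqE] := pq n.
rewrite [X in measurable_fun _ X](_ : _ = (fun y : n.-tuple R => q y)).
  exact: mq.
by apply/funext => y; apply: pqE; rewrite size_tuple.
Qed.

Lemma wbmeas_all (p : nat -> seq R -> bool) (r : seq nat) :
  (forall k, wbmeas (p k)) -> wbmeas (fun y => all (p^~ y) r).
Proof.
move=> mp; elim: r => [|k r IH]; first by move=> n.
exact: wbmeas_and.
Qed.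

Lemma wbmeas_pos s (g : seq R -> R) : wmeas g -> wbmeas (fun y => pos s (g y)).
Proof.
by move=> mg; case: s => /=; [apply: wbmeas_lt|apply: wbmeas_le];
  try exact: mg; exact: wmeas_cst.
Qed.

Lemma wbmeas_post s : wbmeas (@post R s).
Proof.
apply: wbmeas_fixed => n.
exists (fun y => all (fun k => pos s (psum y k.+1)) (iota 0 n)).
  apply: (wbmeas_all (p := fun k y => pos s (psum y k.+1))) => k.
  by apply: wbmeas_pos; exact: wmeas_psum.
by move=> y <-.
Qed.

Lemma wbmeas_pre s : wbmeas (@pre R s).
Proof.
apply: wbmeas_fixed => n.
exists (fun y => all (fun k => ~~ pos s (wsum y - psum y k)) (iota 0 n)).
  apply: (wbmeas_all (p := fun k y => ~~ pos s (wsum y - psum y k))) => k.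
  apply: wbmeasN; apply: wbmeas_pos; apply: wmeasD; first exact: wmeas_wsum.
  by apply: wmeasN; exact: wmeas_psum.
by move=> y <-; apply: eq_all => k; rewrite wsum_drop.
Qed.

Lemma good_post s : good (fun y : seq R => (post s y)%:R).
Proof. by apply: good_ind; exact: wbmeas_post. Qed.

Lemma good_pre s : good (fun y : seq R => (pre s y)%:R).
Proof. by apply: good_ind; exact: wbmeas_pre. Qed.

Lemma lowest_atE s i y : (lowest_at s i y)%:R = (pre s (take i y))%:R *
  (post s (drop i y))%:R :> R.
Proof. by rewrite -natrM mulnb. Qed.

Lemma good_lowest_at s i : good (fun y : seq R => (lowest_at s i y)%:R).
Proof.
apply: good_ext (goodM (good_take i (good_pre s)) (good_drop i (good_post s))) => y.
by rewrite lowest_atE.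
Qed.

(** The quotient is rewritten with a logarithm to reduce its measurability to sums
    and to the exponential. *)
Lemma good_share j : good (share j).
Proof.
split=> n.
  apply: (eq_measurable_fun (fun y : n.-tuple R =>
    expR (- psum y j - ln (\sum_(q < n.+1) expR (- psum y q))))).
    move=> y _; have := share_den_gt0 y; rewrite /share size_tuple => D0.
    by rewrite [LHS]expRD [X in _ * X = _]expRN lnK.
  have mS : wmeas (fun y : seq R => \sum_(q < n.+1) expR (- psum y q)).
    by apply: wmeas_sum => q; apply: wmeas_expR; apply: wmeasN; exact: wmeas_psum.
  apply: measurableT_comp => //; apply: measurable_funB.
    by apply: (wmeasN (wmeas_psum j)).
  exact: measurableT_comp (@measurable_ln R) (mS n).
case: (leqP j n) => [jn|nj].
  exists 1 => y; rewrite ger0_norm ?share_ge0// share_le1// size_tuple//.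
exists 1 => y; rewrite ger0_norm ?share_ge0//.
rewrite (_ : share j y = share (size y) y) ?share_le1//.
by rewrite /share [psum y j]psum_oversize ?psum_size// size_tuple ltnW.
Qed.

Lemma good_exp_post s (h : seq R -> R) : wmeas h ->
  (forall y, post s y -> 0 <= h y) ->
  good (fun y => expR (- h y) * (post s y)%:R).
Proof.
move=> mh h0; apply: (@good_bnd _ _ 1).
  apply: wmeasM; first by apply: wmeas_expR; exact: wmeasN.
  by apply: wbmeas_ind; exact: wbmeas_post.
move=> y; rewrite ger0_norm ?mulr_ge0 ?expR_ge0//.
by case: (boolP (post s y)) => py; rewrite ?mulr0// mulr1 -expR0 ler_expR oppr_le0 h0.
Qed.

Lemma good_exp_pre s (h : seq R -> R) : wmeas h ->
  (forall y, pre s y -> h y <= 0) ->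
  good (fun y => expR (h y) * (pre s y)%:R).
Proof.
move=> mh h0; apply: (@good_bnd _ _ 1).
  apply: wmeasM; first exact: wmeas_expR.
  by apply: wbmeas_ind; exact: wbmeas_pre.
move=> y; rewrite ger0_norm ?mulr_ge0 ?expR_ge0//.
by case: (boolP (pre s y)) => py; rewrite ?mulr0// mulr1 -expR0 ler_expR h0.
Qed.

End weights.

(** * Decomposition of a path at its lowest point *)

Section law_facts.
Context {R : realType} (E : @word_law R).
Implicit Types (s : bool) (y : seq R) (g h : seq R -> R).

Lemma wE_sum n (I : Type) (r : seq I) (F : I -> seq R -> R) :
  (forall i, good (F i)) ->
  E n (fun y => \sum_(i <- r) F i y) = \sum_(i <- r) E n (F i).
Proof.
move=> gF; elim: r => [|i r IH].
  rewrite big_nil -[RHS](wE_cst E n).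
  by apply: wE_ext => y _; rewrite big_nil.
rewrite big_cons -IH -wED//; last exact: good_sum.
by apply: wE_ext => y _; rewrite big_cons.
Qed.

Lemma wE_ge0 n g : good g -> (forall y, size y = n -> 0 <= g y) -> 0 <= E n g.
Proof.
by move=> gg g0; rewrite -(wE_cst E n 0); apply: wE_le => //; exact: good_cst.
Qed.

Lemma wE_drop k n h : good h -> (k <= n)%N ->
  E n (fun y => h (drop k y)) = E (n - k)%N h.
Proof.
move=> gh kn; have := wE_cat E k (n - k) (good_cst 1) gh.
rewrite wE_cst mul1r subnKC// => <-.
by apply: wE_ext => y _; rewrite mul1r.
Qed.

Lemma wE_take k n g : good g -> (k <= n)%N ->
  E n (fun y => g (take k y)) = E k g.
Proof.
move=> gg kn; have := wE_cat E k (n - k) gg (good_cst 1).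
rewrite wE_cst mulr1 subnKC// => <-.
by apply: wE_ext => y _; rewrite mulr1.
Qed.

Definition post_prob s m : R := E m (fun y => (post s y)%:R).
Definition pre_prob s j : R := E j (fun y => (pre s y)%:R).

(** The factor one half leaves a square root of the exponential weight to pay for the
    descent of the remaining path in [post_mass_le]. *)
Definition post_tilt s l : R := E l (fun y => expR (- (wsum y / 2)) * (post s y)%:R).
Definition pre_tilt s l : R := E l (fun y => expR (wsum y / 2) * (pre s y)%:R).

(** Upper bound for the share that a lowest point at time [0] leaves to time [l] when
    [k] further steps follow. *)
Definition post_mass s l k : R :=
  E (l + k)%N (fun y => expR (- psum y l) * (post s y)%:R).

(** A path of length [N] carries a unit of mass, placed at its lowest point [i] and
    handed over to [j] in the proportion [share j]. Summed over [i] the mass received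
    at [j] is the mean share of [j]; summed over [j] the mass sent from [i] is the
    probability that [i] is lowest. *)
Definition flow s N i j : R := E N (fun y => share j y * (lowest_at s i y)%:R).

Lemma wmeas_half : wmeas (fun y : seq R => wsum y / 2).
Proof. by apply: wmeasM; [exact: wmeas_wsum|exact: wmeas_cst]. Qed.

Lemma good_post_tilt s : good (fun y : seq R => expR (- (wsum y / 2)) * (post s y)%:R).
Proof.
apply: good_exp_post; first exact: wmeas_half.
by move=> y py; rewrite divr_ge0// -psum_size (post_psum_ge0 _ py).
Qed.

Lemma good_pre_tilt s : good (fun y : seq R => expR (wsum y / 2) * (pre s y)%:R).
Proof.
apply: good_exp_pre; first exact: wmeas_half.
move=> y py; have := pre_wsum_le0 0 py; rewrite psum0 subr0 => ?.
by rewrite pmulr_lle0// invr_gt0 ltr0n.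
Qed.

Lemma good_post_mass s l : good (fun y : seq R => expR (- psum y l) * (post s y)%:R).
Proof.
apply: good_exp_post; first exact: wmeas_psum.
by move=> y py; exact: post_psum_ge0 py.
Qed.

Lemma good_flow s i j : good (fun y : seq R => share j y * (lowest_at s i y)%:R).
Proof. by apply: goodM; [exact: good_share|exact: good_lowest_at]. Qed.

Lemma post_prob_ge0 s m : 0 <= post_prob s m.
Proof. by apply: wE_ge0 => //; exact: good_post. Qed.

Lemma pre_prob_ge0 s m : 0 <= pre_prob s m.
Proof. by apply: wE_ge0 => //; exact: good_pre. Qed.

Lemma post_tilt_ge0 s m : 0 <= post_tilt s m.
Proof.
by apply: wE_ge0 => [|y _]; [exact: good_post_tilt|rewrite mulr_ge0 ?expR_ge0].
Qed.

Lemma pre_tilt_ge0 s m : 0 <= pre_tilt s m.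
Proof.
by apply: wE_ge0 => [|y _]; [exact: good_pre_tilt|rewrite mulr_ge0 ?expR_ge0].
Qed.

Lemma post_mass_ge0 s l k : 0 <= post_mass s l k.
Proof.
by apply: wE_ge0 => [|y _]; [exact: good_post_mass|rewrite mulr_ge0 ?expR_ge0].
Qed.

Lemma flow_ge0 s N i j : 0 <= flow s N i j.
Proof.
by apply: wE_ge0 => [|y _]; [exact: good_flow|rewrite mulr_ge0 ?share_ge0].
Qed.

Lemma post_prob0 s : post_prob s 0 = 1.
Proof.
rewrite /post_prob -[RHS](wE_cst E 0); apply: wE_ext => y /size0nil ->.
by rewrite /post.
Qed.

Lemma pre_prob0 s : pre_prob s 0 = 1.
Proof.
rewrite /pre_prob -[RHS](wE_cst E 0); apply: wE_ext => y /size0nil ->.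
by rewrite /pre.
Qed.

Lemma post_take s y k : post s y -> post s (take k y).
Proof.
move=> /postP py; apply/postP => i /andP[i0 ik].
have ik' : (i <= k)%N by rewrite (leq_trans ik)// size_take_min geq_minl.
rewrite psum_take//; apply: py; rewrite i0 (leq_trans ik)//.
by rewrite size_take_min geq_minr.
Qed.

Lemma pre_drop s y k : pre s y -> pre s (drop k y).
Proof.
move=> /preP py; apply/preP => i; rewrite size_drop => ik.
rewrite wsum_drop psum_drop (_ : _ - _ = wsum y - psum y (k + i)).
  by apply: py; lia.
ring.
Qed.

Lemma post_prob_noninc s m : post_prob s m.+1 <= post_prob s m.
Proof.
rewrite /post_prob -(wE_take (good_post s) (leqnSn m)); apply: wE_le.
- exact: good_post.
- exact: (good_take m (good_post s)).
move=> y _; rewrite ler_nat; by case: (boolP (post s y)) => // /(post_take m) ->.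
Qed.

Lemma pre_prob_noninc s m : pre_prob s m.+1 <= pre_prob s m.
Proof.
have := wE_drop (good_pre s) (ltn0Sn m); rewrite subn1 /= => H.
rewrite /pre_prob -H; apply: wE_le.
- exact: good_pre.
- exact: (good_drop 1 (good_pre s)).
move=> y _; rewrite ler_nat; by case: (boolP (pre s y)) => // /(pre_drop 1) ->.
Qed.

Lemma post_mass_noninc s l k : post_mass s l k.+1 <= post_mass s l k.
Proof.
rewrite /post_mass addnS -(wE_take (good_post_mass s l) (leqnSn (l + k))); apply: wE_le.
- exact: good_post_mass.
- exact: (good_take _ (good_post_mass s l)).
move=> y _; rewrite psum_take ?leq_addr// ler_wpM2l ?expR_ge0// ler_nat.
by case: (boolP (post s y)) => // /(post_take (l + k)) ->.
Qed.

Lemma Elowest_at s N i : (i <= N)%N ->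
  E N (fun y => (lowest_at s i y)%:R) = pre_prob s i * post_prob s (N - i).
Proof.
move=> iN; rewrite -(wE_cat E _ _ (good_pre s) (good_post s)) subnKC//.
by apply: wE_ext => y _; rewrite lowest_atE.
Qed.

(** Every path has exactly one lowest point. *)
Lemma pre_post_sum1 s N : \sum_(i < N.+1) pre_prob s i * post_prob s (N - i) = 1.
Proof.
rewrite -(wE_cst E N 1).
rewrite (@wE_ext _ E N _ (fun y => \sum_(i < N.+1) (lowest_at s i y)%:R)); last first.
  by move=> y <-; rewrite lowest_at_one.
rewrite wE_sum; last by move=> i; exact: good_lowest_at.
by apply: eq_bigr => i _; rewrite Elowest_at// -ltnS.
Qed.

Lemma flow_sum_pos s N j : \sum_(i < N.+1) flow s N i j = E N (share j).
Proof.
rewrite -wE_sum; last by move=> i; exact: good_flow.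
by apply: wE_ext => y <-; rewrite -mulr_sumr lowest_at_one mulr1.
Qed.

Lemma flow_sum_share s N i : (i <= N)%N ->
  \sum_(j < N.+1) flow s N i j = pre_prob s i * post_prob s (N - i).
Proof.
move=> iN; rewrite -wE_sum; last by move=> j; exact: good_flow.
rewrite -Elowest_at//; apply: wE_ext => y <-.
by rewrite -mulr_suml share_sum1 mul1r.
Qed.

(** The past of the lowest point is independent of its future, and the future bounds
    the share of [j]. *)
Lemma flow_le s N i j : (i <= j <= N)%N ->
  flow s N i j <= pre_prob s i * post_mass s (j - i) (N - j).
Proof.
move=> /andP[ij jN]; have iN := leq_trans ij jN.
rewrite /post_mass (_ : (j - i + (N - j) = N - i)%N); last by lia.
rewrite -(wE_cat E _ _ (good_pre s) (good_post_mass s (j - i))) subnKC//.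
apply: wE_le.
- exact: good_flow.
- by apply: goodM; [exact: (good_take _ (good_pre s))|exact: (good_drop _ (good_post_mass s _))].
move=> y yN; rewrite lowest_atE mulrCA ler_wpM2l// ler_wpM2r//.
rewrite psum_drop subnKC// opprB; apply: share_le; by rewrite yN.
Qed.

(** Monotonicity in [j] for a fixed number [m] of later steps; this is what allows a
    pointwise conclusion to be drawn from sums over [j]. *)
Lemma Eshare_noninc j m : E (j.+1 + m)%N (share j.+1) <= E (j + m)%N (share j).
Proof.
have -> : E (j + m)%N (share j) = E (j.+1 + m)%N (fun y => share j (drop 1 y)).
  by rewrite (wE_drop (good_share j)) addSn // subn1.
apply: wE_le.
- exact: good_share.
- exact: (good_drop 1 (good_share j)).
by move=> y yn; rewrite drop1; apply: share_behead; rewrite yn addSn.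
Qed.

(** A path that stays positive is cut at time [l], and the second piece is cut again at
    its lowest point. The lowest point of the second piece is not below the origin, so
    half of the exponent of the first piece can be traded for the depth reached by the
    second piece, and the three blocks become independent. *)
Lemma post_mass_le s l k :
  post_mass s l k <= post_tilt s l * \sum_(i < k.+1) pre_tilt s i * post_prob s (k - i).
Proof.
pose G i (z : seq R) := (expR (wsum (take i z) / 2) * (pre s (take i z))%:R) *
  (post s (drop i z))%:R.
have gG i : good (G i).
  by apply: goodM; [exact: (good_take i (good_pre_tilt s))|exact: (good_drop i (good_post s))].
have -> : \sum_(i < k.+1) pre_tilt s i * post_prob s (k - i) =
    E k (fun z => \sum_(i < k.+1) G i z).
  rewrite wE_sum//; apply: eq_bigr => i _.
  by rewrite -(wE_cat E _ _ (good_pre_tilt s) (good_post s)) subnKC// -ltnS.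
have gS : good (fun z => \sum_(i < k.+1) G i z).
  by apply: good_sum => i; exact: gG.
rewrite -(wE_cat E _ _ (good_post_tilt s) gS); apply: wE_le.
- exact: good_post_mass.
- by apply: goodM; [exact: (good_take l (good_post_tilt s))|exact: (good_drop l gS)].
move=> y yn; have zk : size (drop l y) = k by rewrite size_drop yn addKn.
case: (boolP (post s y)) => py; last first.
  rewrite mulr0 !mulr_ge0 ?expR_ge0// sumr_ge0// => i _.
  by rewrite !mulr_ge0 ?expR_ge0.
rewrite mulr1 (post_take l py) mulr1.
rewrite -[leLHS]mulr1 -[X in _ * X <= _](lowest_at_one s (drop l y)) zk !mulr_sumr.
apply: ler_sum => i _; rewrite /G -mulrA -lowest_atE mulrA ler_wpM2r// -expRD ler_expR.
have := post_psum_ge0 (l + i) py.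
have -> : wsum (take i (drop l y)) = psum y (l + i) - psum y l by rewrite -psum_drop.
have -> : wsum (take l y) = psum y l by [].
lra.
Qed.

Definition low_posn s n y : R := \sum_(i < n.+1) i%:R * (lowest_at s i y)%:R.

Lemma good_low_posn s n : good (low_posn s n).
Proof.
by apply: good_sum => i; apply: goodM; [exact: good_cst|exact: good_lowest_at].
Qed.

Definition npos_prob s k : R := E k (fun y => (~~ pos s (wsum y))%:R).

Lemma good_npos_wsum s : good (fun y : seq R => (~~ pos s (wsum y))%:R).
Proof.
by apply: good_ind; apply: wbmeasN; apply: wbmeas_pos; exact: wmeas_wsum.
Qed.

Lemma good_pos_wsum s : good (fun y : seq R => (pos s (wsum y))%:R).
Proof. by apply: good_ind; apply: wbmeas_pos; exact: wmeas_wsum. Qed.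

(** Adding a step moves the lowest point by one exactly when the whole increment is not
    positive: by [lowest_drop_last] and [lowest_drop_first] the lowest point of
    [n.+1] steps is that of the first [n] steps, or one plus that of the last [n] steps.
    A cyclic rotation preserves the total increment and the law of the word, and
    exchanges these two subwords. *)
Lemma Elow_pos_succ s n :
  E n.+1 (low_posn s n.+1) = E n (low_posn s n) + npos_prob s n.+1.
Proof.
have gL := good_low_posn s n.
have gP : good (fun y => (pos s (wsum y))%:R * low_posn s n (take n y)).
  by apply: goodM; [exact: good_pos_wsum|exact: (good_take n gL)].
have gN : good (fun y => (~~ pos s (wsum y))%:R * low_posn s n (take n y)).
  by apply: goodM; [exact: good_npos_wsum|exact: (good_take n gL)].
have gN' : good (fun y => (~~ pos s (wsum y))%:R * low_posn s n (drop 1 y)).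
  by apply: goodM; [exact: good_npos_wsum|exact: (good_drop 1 gL)].
have EN : E n.+1 (fun y => (~~ pos s (wsum y))%:R * low_posn s n (drop 1 y)) =
    E n.+1 (fun y => (~~ pos s (wsum y))%:R * low_posn s n (take n y)).
  rewrite -[RHS](wE_rot E _ gN); apply: wE_ext => -[//|x w] [wn].
  rewrite rot1_cons -cats1 take_size_cat// drop1 /=.
  by rewrite wsum_cat addrC -wsum_cat.
rewrite -(wE_take gL (leqnSn n)).
have -> : E n.+1 (fun y => low_posn s n (take n y)) =
    E n.+1 (fun y => (pos s (wsum y))%:R * low_posn s n (take n y)) +
    E n.+1 (fun y => (~~ pos s (wsum y))%:R * low_posn s n (take n y)).
  rewrite -wED//; apply: wE_ext => y _; rewrite -mulrDl.
  by case: (pos _ _); rewrite /= ?addr0 ?add0r mul1r.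
rewrite -EN -addrA /npos_prob -wED//; last exact: good_npos_wsum.
rewrite -wED//; last by apply: goodD => //; exact: good_npos_wsum.
apply: wE_ext => y yn.
have -> : low_posn s n.+1 y = low_pos s y by rewrite /low_pos yn.
have [posy|nposy] := boolP (pos s (wsum y)).
  rewrite (low_pos_take yn posy) /low_pos size_takel ?yn//= mul1r mul0r !addr0//.
rewrite (low_pos_behead yn nposy) /low_pos size_behead yn /= drop1 mul0r mul1r add0r.
by rewrite addrC.
Qed.

(** Sparre Andersen's theorem at the level of means: the expected time of the lowest
    point is the expected number of times at which the walk is not positive. *)
Lemma Elow_pos s n :
  \sum_(i < n.+1) i%:R * (pre_prob s i * post_prob s (n - i)) =
  \sum_(1 <= k < n.+1) npos_prob s k.
Proof.
transitivity (E n (low_posn s n)).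
  rewrite wE_sum; last first.
    by move=> i; apply: goodM; [exact: good_cst|exact: good_lowest_at].
  apply: eq_bigr => i _; rewrite wEZ; last exact: good_lowest_at.
  by rewrite Elowest_at// -ltnS.
elim: n => [|n IH].
  rewrite big_geq// -[RHS](wE_cst E 0); apply: wE_ext => y _.
  by rewrite /low_posn big_ord_recl big_ord0 mul0r addr0.
by rewrite Elow_pos_succ IH [in RHS]big_nat_recr.
Qed.

End law_facts.

(** * Reflected law *)

Section mirror.
Context {R : realType} (E : @word_law R).
Implicit Types (s : bool) (y : seq R) (g h : seq R -> R).

Let M n g := E n (fun y => g (map -%R y)).

Let M_ext n g h : (forall y, size y = n -> g y = h y) -> M n g = M n h.
Proof. by move=> gh; apply: wE_ext => y yn; apply: gh; rewrite size_map. Qed.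

Let M_cst n c : M n (fun=> c) = c. Proof. exact: wE_cst. Qed.

Let MD n g h : good g -> good h -> M n (fun y => g y + h y) = M n g + M n h.
Proof. by move=> gg gh; apply: wED; exact: good_opp. Qed.

Let MZ n c g : good g -> M n (fun y => c * g y) = c * M n g.
Proof. by move=> gg; apply: (@wEZ _ E n c (fun y => g (map -%R y))); exact: good_opp. Qed.

Let M_le n g h : good g -> good h ->
  (forall y, size y = n -> g y <= h y) -> M n g <= M n h.
Proof.
move=> gg gh gleh; apply: wE_le; [exact: good_opp..|].
by move=> y yn; apply: gleh; rewrite size_map.
Qed.

Let M_cat k l g h : good g -> good h ->
  M (k + l) (fun y => g (take k y) * h (drop k y)) = M k g * M l h.
Proof.
move=> gg gh; rewrite /M -(wE_cat E _ _ (good_opp gg) (good_opp gh)).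
by apply: wE_ext => y _; rewrite map_take map_drop.
Qed.

Let M_rot n g : good g -> M n (fun y => g (rot 1 y)) = M n g.
Proof.
move=> gg; rewrite /M -(wE_rot E n (good_opp gg)).
by apply: wE_ext => y _; rewrite map_rot.
Qed.

Let M_rev n g : good g -> M n (fun y => g (rev y)) = M n g.
Proof.
move=> gg; rewrite /M -(wE_rev E n (good_opp gg)).
by apply: wE_ext => y _; rewrite map_rev.
Qed.

Let head_opp y : size y = 1%N -> head 0 (map -%R y) = - head 0 y.
Proof. by case: y. Qed.

Let M_up : 0 < M 1 (fun y => (0 < head 0 y)%R%:R) ->
  exists2 eta, 0 < eta & 0 < M 1 (fun y => (eta < head 0 y)%R%:R).
Proof.
have ME c : M 1 (fun y => (c < head 0 y)%R%:R) =
    E 1 (fun y => (c < - head 0 y)%R%:R).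
  by apply: wE_ext => y y1; rewrite head_opp.
by rewrite ME => /wE_down[eta eta0]; exists eta => //; rewrite ME.
Qed.

Let M_down : 0 < M 1 (fun y => (0 < - head 0 y)%R%:R) ->
  exists2 eta, 0 < eta & 0 < M 1 (fun y => (eta < - head 0 y)%R%:R).
Proof.
have ME c : M 1 (fun y => (c < - head 0 y)%R%:R) =
    E 1 (fun y => (c < head 0 y)%R%:R).
  by apply: wE_ext => y y1; rewrite head_opp// opprK.
by rewrite ME => /wE_up[eta eta0]; exists eta => //; rewrite ME.
Qed.

(** The law of the reflected walk. With [mirror_word] it turns each statement about the
    future of the lowest point into the statement about its past. *)
Definition mirror_law : @word_law R :=
  WordLaw M_ext M_cst MD MZ M_le M_cat M_rot M_rev M_up M_down.

Lemma mirror_lawE n g : good g -> mirror_law n g = E n (fun y => g (mirror_word y)).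
Proof.
move=> gg; rewrite -[LHS](wE_rev E n (good_opp gg)).
by apply: wE_ext => y _; rewrite map_rev.
Qed.

Lemma post_prob_mirror s n : post_prob mirror_law (~~ s) n = pre_prob E s n.
Proof.
rewrite /post_prob mirror_lawE; last exact: good_post.
by apply: wE_ext => y _; rewrite post_mir.
Qed.

Lemma pre_prob_mirror s n : pre_prob mirror_law (~~ s) n = post_prob E s n.
Proof.
rewrite /pre_prob mirror_lawE; last exact: good_pre.
by apply: wE_ext => y _; rewrite pre_mir.
Qed.

Lemma post_tilt_mirror s n : post_tilt mirror_law (~~ s) n = pre_tilt E s n.
Proof.
rewrite /post_tilt mirror_lawE; last exact: good_post_tilt.
by apply: wE_ext => y _; rewrite post_mir wsum_mir mulNr opprK.
Qed.

Lemma pre_tilt_mirror s n : pre_tilt mirror_law (~~ s) n = post_tilt E s n.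
Proof.
rewrite /pre_tilt mirror_lawE; last exact: good_pre_tilt.
by apply: wE_ext => y _; rewrite pre_mir wsum_mir mulNr.
Qed.

Lemma flow_mirror s N i j : (i <= N)%N -> (j <= N)%N ->
  flow mirror_law (~~ s) N (N - i) (N - j) = flow E s N i j.
Proof.
move=> iN jN; rewrite /flow mirror_lawE; last exact: good_flow.
by apply: wE_ext => y yN; rewrite -yN lowest_at_mir ?share_mir ?yN.
Qed.

Lemma npos_prob_mirror s n : npos_prob mirror_law (~~ s) n =
  E n (fun y => (pos s (wsum y))%:R).
Proof.
rewrite /npos_prob mirror_lawE; last exact: good_npos_wsum.
by apply: wE_ext => y _; rewrite wsum_mir posN negbK.
Qed.

End mirror.

(** * Summability of exponentially weighted ladder points *)

Section ladder_bound.
Context {R : realType} (E : @word_law R).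
Implicit Types (s : bool) (y : seq R).

(** Height of the highest point of the path seen backwards from its end; prepending
    letters makes it grow. *)
Fixpoint max_suffix (y : seq R) : R :=
  if y is x :: w then Num.max (max_suffix w) (wsum y) else 0.

Lemma wmeas_max_suffix : wmeas max_suffix.
Proof.
apply: wmeas_fixed; elim=> [|n [h mh hE]].
  by exists (fun=> 0); [exact: wmeas_cst|move=> y /size0nil ->].
exists (fun y => Num.max (h (drop 1 y)) (wsum y)).
  move=> m; apply: measurable_maxr; first exact: (wmeas_drop 1 mh).
  exact: wmeas_wsum.
by move=> [//|x w] [wn]; rewrite /= drop0 hE.
Qed.

Lemma max_suffix_ge0 y : 0 <= max_suffix y.
Proof. by elim: y => //= x w IH; rewrite le_max IH. Qed.

Lemma max_suffix_le y (c : R) : (forall k, 0 <= c + psum y k) -> max_suffix y <= c + wsum y.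
Proof.
elim: y c => [|x w IH] c H /=.
  by have := H 0%N; rewrite psum0 /wsum big_nil.
have xwE : wsum (x :: w) = x + wsum w by rewrite /wsum big_cons.
have c0 : 0 <= c by have := H 0%N; rewrite psum0 addr0.
rewrite ge_max lerDr c0 andbT xwE addrA; apply: IH => k.
by have := H k.+1; rewrite /psum /= {1}/wsum big_cons addrA.
Qed.

Lemma max_suffix_post s y : post s y -> max_suffix y <= wsum y.
Proof.
move=> py; rewrite -[leRHS]add0r; apply: max_suffix_le => k.
by rewrite add0r; exact: post_psum_ge0 py.
Qed.

(** The mean of [expR (- (max_suffix y / 2))] decreases when a letter is prepended. If
    the word stays positive, [max_suffix] is its sum, and a new letter above [eta] lowers
    the exponential by a fixed factor. The decreases telescope to at most one. *)
Lemma post_tilt_sum_le s eta p L : 0 < eta ->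
  p = E 1 (fun y => (eta < head 0 y)%R%:R) ->
  p * (1 - expR (- (eta / 2))) * \sum_(l < L) post_tilt E s l <= 1.
Proof.
move=> eta0 pE; set c := 1 - _.
have c0 : 0 <= c by rewrite subr_ge0 -expR0 ler_expR oppr_le0 divr_ge0// ltW.
pose F y := expR (- (max_suffix y / 2)).
have gF : good F.
  apply: (@good_bnd _ _ 1).
    apply: wmeas_expR; apply: wmeasN; apply: wmeasM; first exact: wmeas_max_suffix.
    exact: wmeas_cst.
  move=> y; rewrite ger0_norm ?expR_ge0// -expR0 ler_expR oppr_le0 divr_ge0//.
  exact: max_suffix_ge0.
have mhd : wbmeas (fun y : seq R => eta < head 0 y).
  apply: wbmeas_lt; first exact: wmeas_cst.
  by move=> n; under eq_fun => y do rewrite -nth0; exact: (wmeas_nth 0).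
pose I y : R := (eta < head 0 y)%R%:R.
have gI : good I by exact: good_ind.
have step l : E l.+1 F + p * c * post_tilt E s l <= E l F.
  have gJ := @good_post_tilt R s.
  have gIJ : good (fun y => I (take 1 y) *
      (expR (- (wsum (drop 1 y) / 2)) * (post s (drop 1 y))%:R)).
    exact: (goodM (good_take 1 gI) (good_drop 1 gJ)).
  have -> : p * c * post_tilt E s l = c * E l.+1 (fun y => I (take 1 y) *
      (expR (- (wsum (drop 1 y) / 2)) * (post s (drop 1 y))%:R)).
    rewrite -add1n (wE_cat E 1 l gI gJ) -/(post_tilt E s l).
    have -> : E 1 I = p by exact/esym/pE.
    by ring.
  rewrite -wEZ// -wED//; last by apply: goodM => //; exact: good_cst.
  have -> : E l F = E l.+1 (fun y => F (drop 1 y)).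
    by rewrite (wE_drop E gF) // subn1.
  apply: wE_le.
  - by apply: goodD => //; apply: goodM => //; exact: good_cst.
  - exact: (good_drop 1 gF).
  move=> [//|x w] _; rewrite /= drop0 take0 /I /=.
  have mono : F (x :: w) <= F w.
    by rewrite ler_expR lerN2 ler_pM2r ?invr_gt0 ?ltr0n//= le_max lexx.
  have [etax|_] /= := boolP (eta < x)%R; last by rewrite mul0r mulr0 addr0.
  have [pw|_] := boolP (post s w); last by rewrite !mulr0 addr0.
  rewrite mul1r mulr1; have sw := max_suffix_post pw.
  have xwE : wsum (x :: w) = x + wsum w by rewrite /wsum big_cons.
  have F1 : F (x :: w) <= expR (- (eta / 2)) * expR (- (wsum w / 2)).
    rewrite -expRD ler_expR /= -opprD lerN2 -mulrDl ler_pM2r ?invr_gt0 ?ltr0n//.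
    by rewrite le_max xwE lerD2r (ltW etax) orbT.
  have F2 : expR (- (wsum w / 2)) <= F w.
    by rewrite ler_expR lerN2 ler_pM2r ?invr_gt0 ?ltr0n.
  rewrite /c mulrBl mul1r; lra.
suff : E L F + p * c * \sum_(l < L) post_tilt E s l <= 1.
  have : 0 <= E L F by apply: wE_ge0 => // y _; exact: expR_ge0.
  lra.
elim: L => [|L IH].
  rewrite big_ord0 mulr0 addr0 -[leRHS](wE_cst E 0).
  by apply: wE_le => //; [exact: good_cst|move=> y /size0nil ->; rewrite /F /= mul0r oppr0 expR0].
rewrite big_ord_recr /=; apply: le_trans IH.
by have := step L; rewrite mulrDr; lra.
Qed.

End ladder_bound.

Section positivity.
Context {R : realType} (E : @word_law R).
Implicit Types (s : bool) (y : seq R) (g h : seq R -> R).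

Lemma post_tilt_bounded s : 0 < E 1 (fun y => (0 < head 0 y)%R%:R) ->
  exists2 D, 0 <= D & forall L, \sum_(l < L) post_tilt E s l <= D.
Proof.
move=> /wE_up[eta eta0]; set p := E 1 _ => p0.
have c0 : 0 < p * (1 - expR (- (eta / 2))).
  by rewrite mulr_gt0// subr_gt0 -expR0 ltr_expR oppr_lt0 divr_gt0.
exists (p * (1 - expR (- (eta / 2))))^-1; first by rewrite invr_ge0 ltW.
move=> L; rewrite -[leRHS]mulr1 ler_pdivlMl//.
exact: post_tilt_sum_le eta0 erefl.
Qed.

End positivity.

(** * Finite sums of nonnegative and nonincreasing sequences *)

Section sums.
Context {R : realType}.
Implicit Types (x : nat -> R).

Lemma sum_restrict x J K : (J <= K)%N ->
  \sum_(j < J) x j = \sum_(j < K) (j < J)%N%:R * x j.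
Proof.
move=> JK; rewrite (big_ord_widen _ x JK) big_mkcond/=; apply: eq_bigr => j _.
by case: (j < J)%N; rewrite ?mul1r ?mul0r.
Qed.

Lemma sum_le_widen x J K : (J <= K)%N -> (forall j, 0 <= x j) ->
  \sum_(j < J) x j <= \sum_(j < K) x j.
Proof.
move=> JK x0; rewrite (sum_restrict x JK); apply: ler_sum => j _.
by rewrite ler_piMl//; case: (_ < _)%N.
Qed.

Lemma sum_triangle (G : nat -> nat -> R) K :
  \sum_(N < K) \sum_(j < N.+1) G j (N - j)%N =
  \sum_(j < K) \sum_(m < K - j) G j m.
Proof.
elim: K => [|K IH]; first by rewrite !big_ord0.
rewrite big_ord_recr /= IH; under [RHS]eq_bigr => j _.
  rewrite subSn; last by rewrite -ltnS.
  rewrite big_ord_recr /=; over.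
rewrite big_split /=; congr (_ + _).
by rewrite [RHS]big_ord_recr /= subnn big_ord0 addr0.
Qed.

Lemma sum_triangle_le (G : nat -> nat -> R) K : (forall j m, 0 <= G j m) ->
  \sum_(N < K) \sum_(j < N.+1) G j (N - j)%N <=
  \sum_(j < K) \sum_(m < K) G j m.
Proof.
move=> G0; rewrite sum_triangle; apply: ler_sum => j _.
by apply: sum_le_widen => //; exact: leq_subr.
Qed.

Lemma sum_conv_le x z M : (forall j, 0 <= x j) -> (forall j, 0 <= z j) ->
  \sum_(k < M) \sum_(i < k.+1) x i * z (k - i)%N <=
  (\sum_(i < M) x i) * \sum_(i < M) z i.
Proof.
move=> x0 z0; rewrite big_distrlr /=.
by apply: (@sum_triangle_le (fun i m => x i * z m)) => j m; rewrite mulr_ge0.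
Qed.

Lemma sum_box (H : nat -> nat -> R) J M :
  \sum_(j < J) \sum_(m < M) H j m =
  \sum_(N < J + M) \sum_(j < N.+1)
    ((j < J) && (N - j < M))%N%:R * H j (N - j)%N.
Proof.
rewrite (@sum_triangle (fun j m => ((j < J) && (m < M))%N%:R * H j m)).
rewrite (sum_restrict (fun j => \sum_(m < M) H j m) (leq_addr M J)).
apply: eq_bigr => j _; have [jJ|Jj] := ltnP j J; last first.
  by rewrite mul0r big1// => m _; rewrite mul0r.
rewrite mul1r (@sum_restrict (H j) _ (J + M - j))//; lia.
Qed.

Definition nonincreasing x := forall k, x k.+1 <= x k.

Lemma nonincreasing_le x i j : nonincreasing x -> (i <= j)%N -> x j <= x i.
Proof.
move=> xn /subnK <-; elim: (j - i)%N => // k IH.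
by rewrite addSn (le_trans (xn _)).
Qed.

(** Largest fraction of the sum of a nonincreasing sequence of [M] terms that its last
    [l] terms can contain. *)
Definition capped_ratio (l M : nat) : R := Num.min 1 (l%:R / M%:R).

Lemma capped_ratio_ge0 l M : 0 <= capped_ratio l M.
Proof. by rewrite le_min ler01 divr_ge0. Qed.

(** The last terms of a nonincreasing sequence are at most average. *)
Lemma sum_tail x l M : (forall k, 0 <= x k) -> nonincreasing x -> (0 < M)%N ->
  \sum_(k < M) (M <= l + k)%N%:R * x k <= capped_ratio l M * \sum_(k < M) x k.
Proof.
move=> x0 xn M0; rewrite /capped_ratio minEle; case: ifPn => [_|].
  rewrite mul1r; apply: ler_sum => k _; rewrite ler_piMl//.
  by case: (_ <= _)%N.
rewrite -ltNge ltr_pdivrMr ?ltr0n// mul1r ltr_nat => lM.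
rewrite mulrAC ler_pdivlMr ?ltr0n//.
rewrite -(big_mkord xpredT (fun k => (M <= l + k)%N%:R * x k)).
rewrite -(big_mkord xpredT x).
have catE (F : nat -> R) : \sum_(0 <= k < M) F k =
    \sum_(0 <= k < M - l) F k + \sum_(M - l <= k < M) F k.
  by rewrite -big_cat_nat//= leq_subr.
rewrite !catE.
rewrite [X in X + _]big_nat_cond [X in X + _]big1 ?add0r; last first.
  move=> k /andP[/andP[_ kM] _]; rewrite (_ : (M <= l + k)%N = false) ?mul0r//.
  lia.
rewrite (_ : \sum_(M - l <= i < M) _ = \sum_(M - l <= i < M) x i); last first.
  rewrite big_nat_cond [RHS]big_nat_cond; apply: eq_bigr => k /andP[/andP[Mk _] _].
  by rewrite (_ : (M <= l + k)%N) ?mul1r//; lia.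
set t := \sum_(M - l <= i < M) x i; set h := \sum_(0 <= i < M - l) x i.
have tle : t <= l%:R * x (M - l)%N.
  have -> : l%:R * x (M - l)%N = \sum_(M - l <= i < M) x (M - l)%N.
    by rewrite sumr_const_nat subKn 1?ltnW// mulr_natl.
  by apply: ler_sum_nat => k /andP[Mk _]; apply: nonincreasing_le.
have hge : (M - l)%:R * x (M - l)%N <= h.
  have -> : (M - l)%:R * x (M - l)%N = \sum_(0 <= i < M - l) x (M - l)%N.
    by rewrite sumr_const_nat subn0 mulr_natl.
  by apply: ler_sum_nat => k /andP[_ kM]; apply: nonincreasing_le => //; exact: ltnW.
have -> : M%:R = (M - l)%:R + l%:R :> R by rewrite -natrD subnK// ltnW.
have H1 : t * (M - l)%:R <= l%:R * x (M - l)%N * (M - l)%:R by rewrite ler_wpM2r.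
have H2 : l%:R * ((M - l)%:R * x (M - l)%N) <= l%:R * h by rewrite ler_wpM2l.
lra.
Qed.

(** Dominated convergence for a convergent series: each factor tends to zero and is at
    most one. *)
Lemma capped_ratio_sum_small x D : (forall l, 0 <= x l) ->
  (forall L, \sum_(l < L) x l <= D) ->
  forall eps, 0 < eps -> exists K, forall M L, (K <= M)%N ->
    \sum_(l < L) x l * capped_ratio l M <= eps.
Proof.
move=> x0 xD eps eps0.
have D0 : 0 <= D by rewrite (le_trans _ (xD 0%N))// big_ord0.
have cvgx : cvgn (series x).
  apply: nondecreasing_is_cvgn.
    apply/nondecreasing_seqP => n.
    by rewrite /series /= big_nat_recr//= lerDl.
  exists D => _ [n _ <-]; by rewrite /series /= big_mkord.
have eps2 : 0 < eps / 2 by rewrite divr_gt0.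
have [L0 tail] : exists L0, forall L, (L0 <= L)%N ->
    \sum_(L0 <= l < L) x l <= eps / 2.
  have /cvgrPdist_lt /(_ _ eps2) [L0 _ HL0] := cvgx.
  exists L0 => L L0L.
  have := HL0 L0 (leqnn _); rewrite /= distrC ltr_distlC => /andP[_ H].
  have : series x L <= limn (series x).
    apply: nondecreasing_cvgn_le => //; apply/nondecreasing_seqP => n.
    by rewrite /series /= big_nat_recr//= lerDl.
  have -> : series x L = series x L0 + \sum_(L0 <= l < L) x l.
    by rewrite /series /= -big_cat_nat.
  by lra.
have [K HK] : exists K : nat, L0%:R * D <= K%:R * (eps / 2).
  exists (Num.trunc (L0%:R * D / (eps / 2))).+1; rewrite -ler_pdivrMr//.
  by apply/ltW/truncnS_gt.
exists K.+1 => M L KM; have M0 : 0 < M%:R :> R by rewrite ltr0n; lia.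
have x1 l : x l * capped_ratio l M <= x l by rewrite ler_piMr// ge_min lexx.
have HM : L0%:R * D / M%:R <= eps / 2.
  rewrite ler_pdivrMr// (le_trans HK)// mulrC ler_wpM2l ?(ltW eps2)//.
  by rewrite ler_nat; lia.
have head : \sum_(0 <= l < L0) x l * capped_ratio l M <= eps / 2.
  apply: le_trans HM.
  have -> : L0%:R * D / M%:R = L0%:R / M%:R * D by ring.
  apply: (@le_trans _ _ (\sum_(0 <= l < L0) x l * (L0%:R / M%:R))).
    apply: ler_sum_nat => l /andP[_ lL0]; rewrite ler_wpM2l// ge_min.
    by rewrite ler_pM2r ?invr_gt0// ler_nat (ltnW lL0) orbT.
  rewrite -mulr_suml mulrC ler_wpM2l ?divr_ge0//.
  by have := xD L0; rewrite -(big_mkord xpredT x).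
rewrite -(big_mkord xpredT (fun l => x l * capped_ratio l M)).
have xf0 l : 0 <= x l * capped_ratio l M by rewrite mulr_ge0// capped_ratio_ge0.
have [L0L|LL0] := leqP L0 L.
  rewrite (@big_cat_nat _ _ _ L0)//=.
  have : \sum_(L0 <= l < L) x l * capped_ratio l M <= eps / 2.
    by apply: le_trans (tail _ L0L); apply: ler_sum_nat => l _.
  by move: head; lra.
apply: (@le_trans _ _ (\sum_(0 <= l < L0) x l * capped_ratio l M)); last by lra.
by rewrite (@big_cat_nat _ _ _ L 0 L0 xpredT) ?(ltnW LL0)//= lerDl sumr_ge0.
Qed.

End sums.

(** * Transport of weight from the lowest point *)

Section flux.
Context {R : realType} (E : @word_law R) (s : bool).

Definition post_sum M : R := \sum_(m < M) post_prob E s m.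
Definition pre_sum J : R := \sum_(j < J) pre_prob E s j.

Definition box J M N i : bool := ((i < J) && (N - i < M))%N.

Definition box_diff (b c : bool) : R := (b (+) c)%:R.

(** Summing over the number of later steps turns the convolution of [post_mass_le] into
    the product of a convergent sum with [post_sum]; this is why sums over rectangles
    are considered rather than single terms. *)
Lemma post_mass_sum_le (D : R) l M : (forall L, \sum_(i < L) pre_tilt E s i <= D) ->
  \sum_(k < M) post_mass E s l k <= post_tilt E s l * D * post_sum M.
Proof.
move=> HD; apply: (@le_trans _ _ (\sum_(k < M) post_tilt E s l *
    \sum_(i < k.+1) pre_tilt E s i * post_prob E s (k - i))).
  by apply: ler_sum => k _; exact: post_mass_le.
rewrite -mulr_sumr -mulrA ler_wpM2l ?post_tilt_ge0//.
apply: le_trans (sum_conv_le _ (pre_tilt_ge0 E s) (post_prob_ge0 E s)) _.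
by rewrite ler_wpM2r// sumr_ge0// => m _; exact: post_prob_ge0.
Qed.

(** Mass that crosses the boundary of the box while it moves forward by [l] starts among
    the last [l] values of the time before, or among the last [l] values of the time
    after. These are a fraction [capped_ratio] of all, since the weights are
    nonincreasing. *)
Lemma forward_flux (D : R) J M : (0 < J)%N -> (0 < M)%N ->
  (forall L, \sum_(i < L) pre_tilt E s i <= D) ->
  \sum_(N < J + M) \sum_(j < N.+1) \sum_(i < j.+1)
     box_diff (box J M N j) (box J M N i) * flow E s N i j <=
  pre_sum J * post_sum M * (D * \sum_(l < J + M) post_tilt E s l * (capped_ratio l J +
    capped_ratio l M)).
Proof.
move=> J0 M0 HD; set K := (J + M)%N.
(* G i l k bounds the mass that a move from i to i + l, followed by k further
   steps, carries across the boundary *)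
pose G i l k : R := ((i < J) && (k < M))%N%:R *
  (((J <= i + l)%N%:R + (M <= l + k)%N%:R) * (pre_prob E s i * post_mass E s l k)).
have G0 i l k : 0 <= G i l k.
  by rewrite !mulr_ge0 ?addr_ge0 ?pre_prob_ge0 ?post_mass_ge0.
have step N j i : (i <= j <= N)%N ->
    box_diff (box J M N j) (box J M N i) * flow E s N i j <= G i (j - i)%N (N - j)%N.
  move=> ijN; have /andP[ij jN] := ijN; rewrite /G mulrA.
  apply: ler_pM; rewrite ?flow_ge0//; last exact: flow_le.
  rewrite subnKC// (_ : (j - i + (N - j) = N - i)%N); last by lia.
  rewrite /box_diff /box.
  have [iJ|Ji] /= := ltnP i J; have [jJ|Jj] /= := ltnP j J;
  have [a|a] /= := ltnP (N - j) M; have [b|b] /= := ltnP (N - i) M;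
  rewrite ?mul1r ?mul0r ?add0r ?addr0 ?lerDl ?lexx ?ler01//; solve [lia | exact: addr_ge0].
apply: (@le_trans _ _ (\sum_(i < K) \sum_(l < K) \sum_(k < K) G i l k)).
  apply: (@le_trans _ _ (\sum_(N < K) \sum_(j < N.+1) \sum_(i < j.+1)
      G i (j - i)%N (N - j)%N)).
    apply: ler_sum => N _; apply: ler_sum => j _; apply: ler_sum => i _.
    by apply: step; have := ltn_ord i; have := ltn_ord j; lia.
  apply: le_trans (@sum_triangle_le _
    (fun j m => \sum_(i < j.+1) G i (j - i)%N m) K _) _ => [j m|].
    by rewrite sumr_ge0.
  rewrite exchange_big /=; under [leRHS]eq_bigr => i _ do rewrite exchange_big /=.
  rewrite [leRHS]exchange_big /=; apply: ler_sum => k _.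
  by apply: (sum_triangle_le (G := fun i l => G i l k)).
have -> : \sum_(i < K) \sum_(l < K) \sum_(k < K) G i l k = \sum_(l < K)
    ((\sum_(i < J) (J <= l + i)%N%:R * pre_prob E s i) * (\sum_(k < M) post_mass E s l k) +
     pre_sum J * (\sum_(k < M) (M <= l + k)%N%:R * post_mass E s l k)).
  rewrite exchange_big /=; apply: eq_bigr => l _; rewrite /pre_sum !big_distrlr /=.
  rewrite -big_split /=.
  have JK : (J <= K)%N by exact: leq_addr.
  have MK : (M <= K)%N by exact: leq_addl.
  under [RHS]eq_bigr => i _.
    rewrite -big_split /= (sum_restrict (fun k => (J <= l + i)%N%:R * pre_prob E s i *
      post_mass E s l k + pre_prob E s i * ((M <= l + k)%N%:R * post_mass E s l k)) MK).
    over.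
  rewrite (sum_restrict (fun i => \sum_(k < K) (k < M)%N%:R * ((J <= l + i)%N%:R *
    pre_prob E s i * post_mass E s l k + pre_prob E s i * ((M <= l +
      k)%N%:R * post_mass E s l k))) JK).
  apply: eq_bigr => i _; rewrite mulr_sumr; apply: eq_bigr => k _.
  by rewrite /G -mulnb natrM (addnC i); ring.
have -> : pre_sum J * post_sum M * (D * \sum_(l < K) post_tilt E s l * (capped_ratio l J +
  capped_ratio l M)) =
    \sum_(l < K) pre_sum J * post_sum M * (D * (post_tilt E s l * (capped_ratio l J +
      capped_ratio l M))).
  by rewrite -!mulr_sumr.
apply: ler_sum => l _.
have PB0 : 0 <= pre_sum J by apply: sumr_ge0 => j _; exact: pre_prob_ge0.
have PA0 : 0 <= post_sum M by apply: sumr_ge0 => j _; exact: post_prob_ge0.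
have raM := @post_mass_sum_le D l M HD.
have ra0 : 0 <= \sum_(k < M) post_mass E s l k by apply: sumr_ge0 => k _; exact: post_mass_ge0.
have H1 : \sum_(i < J) (J <= l + i)%N%:R * pre_prob E s i <= capped_ratio l J * pre_sum J.
  by apply: sum_tail => //; [exact: pre_prob_ge0|exact: pre_prob_noninc].
have H2 : \sum_(k < M) (M <= l + k)%N%:R * post_mass E s l k <=
    capped_ratio l M * \sum_(k < M) post_mass E s l k.
  by apply: sum_tail => //; [exact: post_mass_ge0|exact: post_mass_noninc].
have -> : pre_sum J * post_sum M * (D * (post_tilt E s l * (capped_ratio l J +
  capped_ratio l M))) =
  (capped_ratio l J * pre_sum J) * (post_tilt E s l * D * post_sum M) +
  pre_sum J * (capped_ratio l M * (post_tilt E s l * D * post_sum M)) by ring.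
apply: lerD.
  apply: ler_pM => //; apply: sumr_ge0 => i _; rewrite mulr_ge0//; exact: pre_prob_ge0.
rewrite ler_wpM2l// (le_trans H2)// ler_wpM2l//; exact: capped_ratio_ge0.
Qed.

End flux.

Section transport.
Context {R : realType} (E : @word_law R) (s : bool).

Definition degree_sum J M : R := \sum_(j < J) \sum_(m < M) E (j + m)%N (share j).

Lemma post_sum_mirror n : post_sum (mirror_law E) (~~ s) n = pre_sum E s n.
Proof. by apply: eq_bigr => i _; exact: post_prob_mirror. Qed.

Lemma pre_sum_mirror n : pre_sum (mirror_law E) (~~ s) n = post_sum E s n.
Proof. by apply: eq_bigr => i _; exact: pre_prob_mirror. Qed.

Lemma degree_sum_box J M : degree_sum J M = \sum_(N < J + M) \sum_(j < N.+1)
  \sum_(i < N.+1) (box J M N j)%:R * flow E s N i j.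
Proof.
rewrite /degree_sum (sum_box (fun j m => E (j + m)%N (share j))).
apply: eq_bigr => N _; apply: eq_bigr => j _; rewrite -mulr_sumr flow_sum_pos.
by rewrite subnKC// -ltnS.
Qed.

Lemma prod_sum_box J M : pre_sum E s J * post_sum E s M = \sum_(N < J + M) \sum_(j < N.+1)
  \sum_(i < N.+1) (box J M N i)%:R * flow E s N i j.
Proof.
rewrite /pre_sum /post_sum big_distrlr /= (sum_box (fun i m => pre_prob E s i * post_prob E s m)).
apply: eq_bigr => N _; rewrite [RHS]exchange_big /=; apply: eq_bigr => i _.
by rewrite -mulr_sumr flow_sum_share// -ltnS.
Qed.

(** Inside a box the mass received is [degree_sum] and the mass sent is
    [pre_sum * post_sum]; they differ by the mass that crosses the boundary. Backward
    moves are the forward moves of the mirrored walk. *)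
Lemma transport (D : R) J M : (0 < J)%N -> (0 < M)%N ->
  (forall L, \sum_(i < L) post_tilt E s i <= D) ->
  (forall L, \sum_(i < L) pre_tilt E s i <= D) ->
  `|degree_sum J M - pre_sum E s J * post_sum E s M| <= pre_sum E s J * post_sum E s M * (D *
    \sum_(l < J + M) (post_tilt E s l + pre_tilt E s l) * (capped_ratio l J +
      capped_ratio l M)).
Proof.
move=> J0 M0 Da Db; set K := (J + M)%N.
pose W N i j : R := box_diff (box J M N j) (box J M N i) * flow E s N i j.
have W0 N i j : 0 <= W N i j by rewrite mulr_ge0 ?flow_ge0.
have leW : `|degree_sum J M - pre_sum E s J * post_sum E s M| <=
    \sum_(N < K) \sum_(j < N.+1) \sum_(i < N.+1) W N i j.
  rewrite degree_sum_box prod_sum_box -sumrB (le_trans (ler_norm_sum _ _ _))//.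
  apply: ler_sum => N _; rewrite -sumrB (le_trans (ler_norm_sum _ _ _))//.
  apply: ler_sum => j _; rewrite -sumrB (le_trans (ler_norm_sum _ _ _))//.
  apply: ler_sum => i _; rewrite -mulrBl normrM [X in _ * X]ger0_norm ?flow_ge0//.
  rewrite ler_wpM2r ?flow_ge0// /box_diff.
  by case: (box _ _ _ _); case: (box _ _ _ _); rewrite ?subrr ?subr0 ?sub0r ?normrN ?normr0 ?normr1.
apply: (le_trans leW).
have fwd := forward_flux J0 M0 Db.
have Da' L : \sum_(i < L) pre_tilt (mirror_law E) (~~ s) i <= D.
  by under eq_bigr => i _ do rewrite pre_tilt_mirror.
have bwd := forward_flux M0 J0 Da'.
rewrite post_sum_mirror pre_sum_mirror in bwd.
apply: (@le_trans _ _ (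
  \sum_(N < K) \sum_(j < N.+1) \sum_(i < j.+1) W N i j +
  \sum_(N < K) \sum_(j < N.+1) \sum_(i < j.+1) W N (N - i)%N (N - j)%N)).
  rewrite -big_split /=; apply: ler_sum => N _.
  rewrite [X in _ + X](reindex_inj rev_ord_inj) /= -big_split /=.
  apply: ler_sum => j _; have jN : (j <= N)%N by rewrite -ltnS.
  rewrite subSS subKn// (@sum_restrict _ (fun i => W N i j) j.+1 N.+1)//.
  rewrite (@sum_restrict _ (fun i => W N (N - i)%N j) (N - j).+1 N.+1); last by lia.
  rewrite [X in _ + X](reindex_inj rev_ord_inj) /= -big_split /=.
  apply: ler_sum => i _; have iN : (i <= N)%N by rewrite -ltnS.
  rewrite subSS subKn// -mulrDl ler_peMl// -natrD ler1n !ltnS; lia.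
have -> : \sum_(l < K) (post_tilt E s l + pre_tilt E s l) * (capped_ratio l J +
  capped_ratio l M) =
    \sum_(l < K) post_tilt E s l * (capped_ratio l J + capped_ratio l M) +
    \sum_(l < K) pre_tilt E s l * (capped_ratio l J + capped_ratio l M).
  by rewrite -big_split; apply: eq_bigr => l _; rewrite /= mulrDl.
rewrite !mulrDr; apply: lerD; first exact: fwd.
rewrite [pre_sum E s J * _]mulrC.
have -> : \sum_(l < K) pre_tilt E s l * (capped_ratio l J + capped_ratio l M) =
    \sum_(l < M + J) post_tilt (mirror_law E) (~~ s) l * (capped_ratio l M + capped_ratio l J).
  by rewrite /K addnC; apply: eq_bigr => l _; rewrite post_tilt_mirror [capped_ratio l J +
    _]addrC.
apply: le_trans bwd; rewrite /K addnC le_eqVlt; apply/orP; left; apply/eqP.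
apply: eq_bigr => N _; apply: eq_bigr => j _; apply: eq_bigr => i _.
have jN : (j <= N)%N by rewrite -ltnS.
have iN : (i <= N)%N by have := ltn_ord i; lia.
rewrite /W -(flow_mirror E s (leq_subr i N) (leq_subr j N)) !subKn//.
by rewrite /box !subKn// ![((N - _ < J) && _)%N]andbC.
Qed.

End transport.

(** * Convolution of sequences *)

Section convolution.
Context {R : realType}.
Implicit Types (x y z a b q : nat -> R).

Definition conv x y n : R := \sum_(i < n.+1) x i * y (n - i)%N.

Lemma convE x y n N : (n < N)%N ->
  conv x y n = (\poly_(i < N) x i * \poly_(i < N) y i)`_n.
Proof.
move=> nN; rewrite coefM; apply: eq_bigr => i _; rewrite !coef_poly.
rewrite (leq_ltn_trans (leq_subr i n) nN).
by rewrite (leq_ltn_trans _ nN)// -ltnS.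
Qed.

(** Truncated sequences are polynomials, whose product is associative and commutative. *)
Lemma conv_ACA x y z n : conv (conv x y) z n = conv (conv x z) y n.
Proof.
have H u v w : conv (conv u v) w n =
    ((\poly_(i < n.+1) u i * \poly_(i < n.+1) v i) * \poly_(i < n.+1) w i)`_n.
  rewrite coefM; apply: eq_bigr => i _.
  by rewrite -convE// coef_poly ltnS leq_subr.
by rewrite !H mulrAC.
Qed.

Lemma conv_cancel a x y : a 0%N = 1 -> (forall n, conv x a n = conv y a n) ->
  forall n, x n = y n.
Proof.
move=> a0 H n; have [m] := ubnP n; elim: m n => // m IH n nm.
have := H n; rewrite /conv !big_ord_recr /= subnn a0 !mulr1.
rewrite (_ : \sum_(i < n) x i * _ = \sum_(i < n) y i * a (n - i)%N); last first.
  apply: eq_bigr => i _; rewrite IH//; have := ltn_ord i; lia.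
exact: addrI.
Qed.

(** In terms of generating functions the hypotheses are [a b = 1 / (1 - s)] and
    [a s b' = q / (1 - s)], and the conclusion is [s b' = b q]. *)
Lemma renewal_identity a b q : a 0%N = 1 ->
  (forall n, \sum_(i < n.+1) b i * a (n - i)%N = 1) ->
  (forall n, \sum_(i < n.+1) i%:R * (b i * a (n - i)%N) =
             \sum_(1 <= k < n.+1) q k) ->
  forall n, n%:R * b n = \sum_(i < n) b i * q (n - i)%N.
Proof.
move=> a0 ba1 nba n.
pose q' k := if k is 0 then 0 else q k.
transitivity (conv b q' n); last first.
  rewrite /conv big_ord_recr /= subnn mulr0 addr0; apply: eq_bigr => i _.
  by have : (0 < n - i)%N; [rewrite subn_gt0|rewrite /q'; case: (n - i)%N].
move: n; apply: (conv_cancel a0) => n.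
rewrite conv_ACA /conv.
under eq_bigr => i _ do rewrite -mulrA.
under [RHS]eq_bigr => i _ do rewrite [X in X * _]ba1 mul1r.
rewrite nba big_add1 /= big_mkord [RHS](reindex_inj rev_ord_inj) /=.
rewrite [RHS]big_ord_recl /= subSS subn0 subnn add0r; apply: eq_bigr => i _.
by rewrite /bump leq0n add1n !subSS subKn.
Qed.

End convolution.

(** * Regular growth under an averaged condition *)

Section abel.
Context {R : realType}.
Implicit Types (x e : nat -> R).

(** Summation by parts. *)
Lemma abel_bound x e c n : (forall i, 0 <= x i) -> nonincreasing x ->
  (forall j, (j <= n)%N -> `|\sum_(i < j) e i| <= c) ->
  `|\sum_(i < n) x i * e i| <= c * x 0%N.
Proof.
move=> x0 xn ec.
have H m : (m <= n)%N ->
    `|\sum_(i < m) x i * e i - x m * \sum_(i < m) e i| <= c * (x 0%N - x m).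
  elim: m => [|m IH] mn.
    by rewrite !big_ord0 mulr0 subrr normr0 subrr mulr0.
  have := IH (ltnW mn); have := ec _ mn; rewrite !big_ord_recr /=.
  set S := \sum_(i < m) x i * e i; set s := \sum_(i < m) e i.
  move=> Hs HS; have -> : S + x m * e m - x m.+1 * (s + e m) =
    (S - x m * s) + (x m - x m.+1) * (s + e m) by ring.
  apply: le_trans (ler_normD _ _) _.
  rewrite normrM [X in _ + X * _]ger0_norm ?subr_ge0//.
  have : (x m - x m.+1) * `|s + e m| <= (x m - x m.+1) * c.
    by rewrite ler_wpM2l ?subr_ge0.
  lra.
have := H n (leqnn n); have := ec n (leqnn n).
set S := \sum_(i < n) x i * e i; set s := \sum_(i < n) e i => Hs HS.
have -> : S = (S - x n * s) + x n * s by ring.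
apply: le_trans (ler_normD _ _) _; rewrite normrM [X in _ + X * _]ger0_norm//.
have : x n * `|s| <= x n * c by rewrite ler_wpM2l.
lra.
Qed.

End abel.

Section density.
Context {R : realType}.
Variables (b q : nat -> R) (sigma : R).
Hypotheses (bge0 : forall n, 0 <= b n) (bn : nonincreasing b).
Hypothesis bq : forall n, n%:R * b n = \sum_(i < n) b i * q (n - i)%N.
Hypothesis q01 : forall k, 0 <= q k <= 1.
Hypothesis sigma01 : 0 < sigma <= 1.
Let Q n := \sum_(i < n) q i.+1.
Hypothesis qsigma : forall eps, 0 < eps -> exists N, forall n, (N <= n)%N ->
  `|Q n - sigma * n%:R| <= eps * n%:R.

Let B n := \sum_(i < n) b i.
Let S n := \sum_(m < n) B m.

Let q_dist k : `|q k - sigma| <= 1.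
Proof.
have /andP[q0 q1] := q01 k; have /andP[s0 s1] := sigma01.
by rewrite ler_norml; apply/andP; split; lra.
Qed.

(** The bound holds for all [n] at the cost of a constant. *)
Let Q_dist eps : 0 < eps -> exists2 C, 0 <= C & forall n,
  `|Q n - sigma * n%:R| <= eps * n%:R + C.
Proof.
move=> eps0; have [N HN] := qsigma eps0; exists N%:R => // n.
have [Nn|nN] := leqP N n; first by rewrite (le_trans (HN n Nn))// lerDl.
have -> : Q n - sigma * n%:R = \sum_(i < n) (q i.+1 - sigma).
  by rewrite sumrB sumr_const card_ord mulr_natr.
rewrite (le_trans (ler_norm_sum _ _ _))//.
apply: (@le_trans _ _ (\sum_(i < n) 1)); first exact: ler_sum.
rewrite sumr_const card_ord (@le_trans _ _ N%:R)//; first by rewrite ler_nat ltnW.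
by rewrite lerDr mulr_ge0// ltW.
Qed.

Let B_ge0 n : 0 <= B n. Proof. by rewrite sumr_ge0. Qed.

Let B_mono m n : (m <= n)%N -> B m <= B n.
Proof. by move=> mn; exact: sum_le_widen. Qed.

Let S_ge0 n : 0 <= S n. Proof. by rewrite sumr_ge0. Qed.

Let SS n : S n.+1 = S n + B n.
Proof. by rewrite /S big_ord_recr. Qed.

Let sum_shift (z : nat -> R) m :
  \sum_(n < m.+1) \sum_(i < n) b i * z (n - i)%N =
  \sum_(i < m.+1) b i * \sum_(k < m - i) z k.+1.
Proof.
pose z' k := if k is 0 then 0 else z k.
transitivity (\sum_(n < m.+1) \sum_(i < n.+1) b i * z' (n - i)%N).
  apply: eq_bigr => n _; rewrite big_ord_recr /= subnn mulr0 addr0.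
  apply: eq_bigr => i _.
  by have : (0 < n - i)%N; [rewrite subn_gt0|rewrite /z'; case: (n - i)%N].
rewrite (sum_triangle (fun i k => b i * z' k)); apply: eq_bigr => i _.
rewrite subSn; last by rewrite -ltnS.
by rewrite big_ord_recl /= mulr0 add0r mulr_sumr.
Qed.

Let S_E m : S m.+1 = \sum_(i < m.+1) b i * (m - i)%:R.
Proof.
transitivity (\sum_(n < m.+1) \sum_(i < n) b i * 1).
  by apply: eq_bigr => n _; apply: eq_bigr => i _; rewrite mulr1.
rewrite (sum_shift (fun=> 1)); apply: eq_bigr => i _.
by rewrite sumr_const card_ord.
Qed.

(** Summing the recursion over [n] involves only the averages of [q], and gives
    a lower bound of order [(1 + sigma) S n] for [n B n]; a part of [sigma] pays for the
    error terms. *)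
Let growth_step : exists2 n0, (0 < n0)%N & forall n, (n0 <= n)%N ->
  (1 + sigma / 4) * S n <= n%:R * B n.
Proof.
have /andP[s0 _] := sigma01.
have s2 : 0 < sigma / 2 by rewrite divr_gt0.
have [C C0 HC] := Q_dist s2.
exists (Num.trunc ((1 + sigma / 4) * C / (sigma / 4))).+1 => // -[//|m] mn.
have mC : (1 + sigma / 4) * C <= m.+1%:R * (sigma / 4).
  rewrite -ler_pdivrMr ?divr_gt0//; apply: le_trans (ltW (truncnS_gt _)) _.
  by rewrite ler_nat.
have E1 : \sum_(i < m.+1) b i * Q (m - i)%N = m%:R * B m.+1 - S m.+1.
  rewrite /Q -sum_shift.
  transitivity (\sum_(n < m.+1) n%:R * b n); first by apply: eq_bigr => n _; rewrite bq.
  rewrite S_E /B mulr_sumr -sumrB; apply: eq_bigr => i _.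
  by rewrite natrB; [ring|rewrite -ltnS].
have E2 : sigma / 2 * S m.+1 - C * B m.+1 <= \sum_(i < m.+1) b i * Q (m - i)%N.
  rewrite S_E /B !mulr_sumr -sumrB; apply: ler_sum => i _.
  have := HC (m - i)%N; rewrite ler_norml => /andP[H _].
  have -> : sigma / 2 * (b i * (m - i)%:R) - C * b i =
    b i * (sigma / 2 * (m - i)%:R - C) by ring.
  by rewrite ler_wpM2l//; lra.
have E3 : (1 + sigma / 2) * S m.+1 <= (m.+1%:R + C) * B m.+1.
  have := B_ge0 m.+1; rewrite E1 in E2; rewrite -(natr1 m); lra.
have p2 : 0 < 1 + sigma / 2 by lra.
rewrite -(ler_pM2l p2) mulrCA.
apply: (@le_trans _ _ ((1 + sigma / 4) * ((m.+1%:R + C) * B m.+1))).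
  by rewrite ler_wpM2l//; lra.
rewrite !mulrA ler_wpM2r//; lra.
Qed.

Let D n := S n / n%:R.

(** Since [S n.+1 - S n = B n], the previous bound makes the means [D n] grow by a fixed
    factor whenever [n] is doubled. *)
Let D_double : exists2 n0, (0 < n0)%N & forall n, (n0 <= n)%N ->
  (1 + sigma / 8) * D n <= D (n + n)%N.
Proof.
have /andP[s0 _] := sigma01.
have [n0 n00 Hn0] := growth_step; exists n0 => // n n0n.
have npos k : (n0 <= k)%N -> 0 < k%:R :> R by move=> ?; rewrite ltr0n; lia.
have step k : (n0 <= k)%N -> D k + sigma / 4 * (D k / k.+1%:R) <= D k.+1.
  move=> nk; rewrite /D SS; have k0 := npos k nk; have := Hn0 k nk => H.
  rewrite [leRHS]mulrC ler_pdivlMl ?ltr0n//.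
  have -> : k.+1%:R * (S k / k%:R + sigma / 4 * (S k / k%:R / k.+1%:R)) =
     S k + (1 + sigma / 4) * S k / k%:R.
    by rewrite -(natr1 k); field; rewrite gt_eqF//= natr1 pnatr_eq0.
  by rewrite lerD2l ler_pdivrMr// [leRHS]mulrC.
have Dn0 : 0 <= D n by rewrite divr_ge0.
suff H k : (k <= n)%N -> D n + k%:R * (sigma / 4 * (D n / (n + n)%:R)) <= D (n + k)%N.
  have := H n (leqnn n); apply: le_trans; rewrite natrD.
  have n_pos := npos n n0n.
  have -> : n%:R * (sigma / 4 * (D n / (n%:R + n%:R))) = sigma / 8 * D n.
    by field; rewrite -natrD pnatr_eq0; lia.
  by lra.
elim: k => [|k IH] kn; first by rewrite mul0r addr0 addn0.
rewrite addnS; apply: le_trans (step _ (leq_trans n0n (leq_addr _ _))).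
have IH' := IH (ltnW kn).
have DnDk : D n <= D (n + k)%N.
  apply: le_trans IH'; rewrite lerDl !mulr_ge0//; lra.
rewrite -(natr1 k) mulrDl mul1r addrA; apply: lerD => //.
rewrite ler_wpM2l//; first by lra.
by apply: ler_pM => //; rewrite lef_pV2 ?posrE ?ltr0n ?ler_nat; lia.
Qed.

(** [B] and its means [D] are comparable up to a doubling, so [B] inherits unbounded
    relative growth. *)
Let growth delta : 0 < delta -> exists K n0, [/\ (0 < K)%N, (0 < n0)%N &
  forall m n, (n0 <= m)%N -> (K * m <= n)%N -> B m <= delta * B n].
Proof.
move=> d0; have /andP[s0 _] := sigma01.
have [n0 n00 Hn0] := D_double.
have iter r m : (n0 <= m)%N -> (1 + r%:R * (sigma / 8)) * D m <= D (2 ^ r * m)%N.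
  move=> nm; elim: r => [|r IH]; first by rewrite mul0r addr0 mul1r mul1n.
  have nrm : (n0 <= 2 ^ r * m)%N by rewrite (leq_trans nm)// leq_pmull// expn_gt0.
  rewrite expnS -mulnA mul2n -addnn; apply: le_trans (Hn0 _ nrm).
  have Dm : 0 <= D m by rewrite divr_ge0.
  have : D m <= D (2 ^ r * m)%N.
    by apply: le_trans IH; rewrite ler_peMl// lerDl mulr_ge0//; lra.
  move=> H; have : sigma / 8 * D m <= sigma / 8 * D (2 ^ r * m)%N.
    by rewrite ler_wpM2l//; lra.
  by rewrite -(natr1 r); lra.
have BD n : (0 < n)%N -> D n <= B n.
  move=> n_; rewrite ler_pdivrMr ?ltr0n//.
  have -> : B n * n%:R = \sum_(m < n) B n by rewrite sumr_const card_ord mulr_natr.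
  by apply: ler_sum => m _; apply: B_mono; exact: ltnW.
have DB n : (0 < n)%N -> B n <= 2 * D (2 * n)%N.
  move=> n_; have -> : 2 * D (2 * n)%N = S (2 * n)%N / n%:R.
    by rewrite /D natrM; field; rewrite pnatr_eq0 -lt0n.
  rewrite ler_pdivlMr ?ltr0n//.
  have -> : B n * n%:R = \sum_(m < n) B n by rewrite sumr_const card_ord mulr_natr.
  rewrite mul2n -addnn /S big_split_ord /= -[leLHS]add0r; apply: lerD.
    exact: sumr_ge0.
  by apply: ler_sum => m _; apply: B_mono; exact: leq_addr.
pose r := (Num.trunc (2 / delta / (sigma / 8))).+1.
have rd : 2 <= delta * (1 + r%:R * (sigma / 8)).
  have : 2 / delta / (sigma / 8) < r%:R by exact: truncnS_gt.
  rewrite ltr_pdivrMr; last by lra.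
  by rewrite ltr_pdivrMr// mulrDr mulr1; lra.
exists (2 ^ r * 2)%N, n0; split => //; first by rewrite muln_gt0 expn_gt0.
move=> m n nm mn; have m0 : (0 < m)%N by lia.
apply: le_trans (DB m m0) _.
have n2m : (n0 <= 2 * m)%N by lia.
have := iter r _ n2m; set d := D (2 * m)%N => H.
have d_0 : 0 <= d by rewrite divr_ge0.
apply: (@le_trans _ _ (delta * ((1 + r%:R * (sigma / 8)) * d))).
  by rewrite [leRHS]mulrA ler_wpM2r.
rewrite ler_wpM2l ?(ltW d0)// (le_trans H)//.
have pos : (0 < 2 ^ r * (2 * m))%N by rewrite muln_gt0 expn_gt0 /=; lia.
by rewrite (le_trans (BD _ pos))// B_mono// mulnA.
Qed.

Let Q_sub N j : (j <= N)%N ->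
  \sum_(k < j) (q (N - k)%N - sigma) =
  (Q N - sigma * N%:R) - (Q (N - j)%N - sigma * (N - j)%:R).
Proof.
elim: j => [|j IH] jN; first by rewrite big_ord0 subn0 subrr.
rewrite big_ord_recr /= IH ?(ltnW jN)//.
have [m ->] : exists m, N = (m + j.+1)%N by exists (N - j.+1)%N; rewrite subnK.
rewrite addnK addnS -addSn addnK /Q [in X in _ - X + _]big_ord_recr /=.
by rewrite -[in X in _ - (_ - X) + _](natr1 m); ring.
Qed.

(** If [q k] were close to [sigma] for each [k], the recursion would give the result
    directly. Only averages are controlled: the terms with [i < L], where [L] is a small
    fraction of [n], contribute at most [B L], which is negligible by [growth]; on the
    other terms summation by parts brings in averages of [q] only, with [b L <= B L / L]. *)
Lemma density_ratio eps : 0 < eps -> exists N, forall n, (N <= n)%N ->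
  `|n%:R * b n - sigma * B n| <= eps * B n.
Proof.
move=> eps0; have e3 : 0 < eps / 3 by rewrite divr_gt0.
have [K [n0 [K0 n00 grow]]] := growth e3.
have KR : 0 < K%:R :> R by rewrite ltr0n.
have e1 : 0 < (4 * K%:R : R)^-1 by rewrite invr_gt0 mulr_gt0.
have [C C0 HC] := Q_dist e1.
pose L0 := (n0 + (Num.trunc (2 * C)).+1)%N.
exists (K * L0)%N => n Kn; pose L := (n %/ K)%N.
have L0L : (L0 <= L)%N by rewrite leq_divRL// mulnC.
have Ln : (L <= n)%N by exact: leq_div.
have LC : 2 * C <= L%:R.
  apply: le_trans (ltW (truncnS_gt _)) _; rewrite ler_nat (leq_trans _ L0L)//.
  exact: leq_addl.
have L1 : (0 < L)%N by rewrite (leq_trans _ L0L)// /L0 addnS.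
have Lpos : 0 < L%:R :> R by rewrite ltr0n.
have nLK : n%:R <= 2 * L%:R * K%:R :> R.
  rewrite -!natrM ler_nat (leq_trans (ltnW (ltn_ceil n K0)))// leq_mul2r.
  by rewrite mul2n -addnn -addn1 leq_add2l L1 orbT.
have BL : B L <= eps / 3 * B n.
  apply: grow; first by rewrite (leq_trans _ L0L)// leq_addr.
  by rewrite mulnC; exact: leq_trunc_div.
have -> : n%:R * b n - sigma * B n = \sum_(i < n) b i * (q (n - i)%N - sigma).
  rewrite bq /B mulr_sumr -sumrB; apply: eq_bigr => i _; ring.
(* the sum is split at L = n %/ K: then B L <= eps / 3 * B n, whereas n / L <= 2 K *)
rewrite -(big_mkord xpredT (fun i => b i * (q (n - i)%N - sigma))).
rewrite (@big_cat_nat _ _ _ L 0 n xpredT)//=.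
apply: le_trans (ler_normD _ _) _.
have H1 : `|\sum_(0 <= i < L) b i * (q (n - i)%N - sigma)| <= B L.
  rewrite big_mkord (le_trans (ler_norm_sum _ _ _))//; apply: ler_sum => i _.
  by rewrite normrM ger0_norm// ler_piMr.
have bL : b L <= B L / L%:R.
  rewrite ler_pdivlMr//.
  have -> : b L * L%:R = \sum_(i < L) b L by rewrite sumr_const card_ord mulr_natr.
  by apply: ler_sum => i _; apply: nonincreasing_le => //; exact: ltnW.
have H2 : `|\sum_(L <= i < n) b i * (q (n - i)%N - sigma)| <=
    2 * ((4 * K%:R)^-1 * n%:R + C) * b L.
  rewrite -[X in \sum_(X <= _ < _) _]add0n big_addn big_mkord.
  have -> : \sum_(i < n - L) b (i + L)%N * (q (n - (i + L))%N - sigma) =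
     \sum_(i < n - L) b (i + L)%N * (q (n - L - i)%N - sigma).
    by apply: eq_bigr => i _; rewrite addnC subnDA.
  apply: (@abel_bound _ (fun i => b (i + L)%N) (fun i => q (n - L - i)%N - sigma)).
  - by move=> i; exact: bge0.
  - by move=> i; exact: bn.
  move=> j jn; rewrite Q_sub// (le_trans (ler_normB _ _))//.
  have mono m : (m <= n)%N -> `|Q m - sigma * m%:R| <= (4 * K%:R)^-1 * n%:R + C.
    move=> mn; apply: le_trans (HC m) _; rewrite lerD2r ler_wpM2l ?(ltW e1)//.
    by rewrite ler_nat.
  have := mono (n - L)%N (leq_subr _ _).
  have mono2 := mono (n - L - j)%N (leq_trans (leq_subr _ _) (leq_subr _ _)).
  by move: mono2; lra.
have H3 : 2 * ((4 * K%:R)^-1 * n%:R + C) <= 2 * L%:R.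
  have : (4 * K%:R)^-1 * n%:R <= L%:R / 2 :> R.
    rewrite ler_pdivrMl ?mulr_gt0//; apply: le_trans nLK _.
    by rewrite le_eqVlt; apply/orP; left; apply/eqP; field.
  by lra.
have H4 : 2 * ((4 * K%:R)^-1 * n%:R + C) * b L <= 2 * B L.
  apply: (@le_trans _ _ (2 * L%:R * b L)); first by rewrite ler_wpM2r.
  by rewrite -mulrA ler_wpM2l// mulrC -ler_pdivlMr.
by move: H1 H2 H4 BL; lra.
Qed.

End density.

(** * Monotone density *)

Section monotone_density.
Context {R : realType}.

Lemma block_sum_le (x : nat -> R) m d : nonincreasing x ->
  d%:R * x (m + d)%N <= \sum_(i < m + d) x i - \sum_(i < m) x i <= d%:R * x m.
Proof.
move=> xn; rewrite big_split_ord /= addrAC subrr add0r.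
have cE (c : R) : d%:R * c = \sum_(i < d) c by rewrite sumr_const card_ord mulr_natl.
rewrite !cE; apply/andP; split; apply: ler_sum => i _; apply: nonincreasing_le => //.
  by rewrite leq_add2l ltnW.
exact: leq_addr.
Qed.

(** Block length [d] close to [j / k]. *)
Lemma small_block k K0 j : (2 <= k)%N -> (2 * K0 + k <= j)%N -> exists d,
  [/\ (0 < d)%N, (2 * d <= j)%N, (d * k <= j)%N, (j <= 2 * k * d)%N &
      (K0 <= j - d)%N].
Proof.
move=> k2 Kj; have k0 : (0 < k)%N by lia.
have kd := leq_trunc_div j k; have jk := ltn_ceil j k0.
have d1 : (0 < j %/ k)%N by rewrite divn_gt0//; lia.
move: kd jk d1; set d := (j %/ k)%N => kd jk d1; exists d.
have kdd : (2 * d <= d * k)%N by rewrite mulnC leq_mul2l k2 orbT.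
have dk : (k <= d * k)%N by rewrite leq_pmull.
split => //; [lia| |lia].
by rewrite mulSn in jk; rewrite -mulnA [(k * d)%N]mulnC; lia.
Qed.

Variables (x : nat -> nat -> R) (y : nat -> R) (sigma : R).
Let Y n := \sum_(i < n) y i.
Hypotheses (xn : forall M, nonincreasing (x^~ M)) (y0 : forall j, 0 <=
  y j) (yn : nonincreasing y).
Hypothesis sigma0 : 0 <= sigma.
Hypothesis xY : forall eps, 0 < eps -> exists K, forall J M, (K <= J)%N ->
  (K <= M)%N -> `|\sum_(j < J) x j M - Y J| <= eps * Y J.
Hypothesis yY : forall eps, 0 < eps -> exists N, forall n, (N <= n)%N ->
  `|n%:R * y n - sigma * Y n| <= eps * Y n.

(** A term of a nonincreasing sequence lies between its averages over the blocks of
    length [d] before and after it, with [d] a small fraction [1 / k] of [j]. The blocks of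
    [x] and [y] differ by at most [2 e1 Y j], which is small relative to [d] once
    [e1 = 1 / k ^ 2]. The extra index [M] carries uniformity in a second parameter. *)
Lemma monotone_density eps : 0 < eps -> exists K, forall J M, (K <= J)%N ->
  (K <= M)%N -> `|J%:R * x J M - sigma * Y J| <= eps * Y J.
Proof.
move=> eps0.
have [k k2 keps] : exists2 k, (2 <= k)%N & 9 / k%:R <= eps.
  exists (Num.trunc (9 / eps)).+2 => //.
  rewrite ler_pdivrMr ?ltr0n// mulrC -ler_pdivrMr//.
  by apply: le_trans (ltW (truncnS_gt _)) _; rewrite ler_nat.
have k0 : 0 < k%:R :> R by rewrite ltr0n; lia.
have ik0 : 0 < k%:R^-1 :> R by rewrite invr_gt0.
have ik2 : k%:R^-1 <= 2^-1 :> R by rewrite lef_pV2 ?posrE// ler_nat.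
have [e1 [e10 e1k ke1]] : exists e1 : R,
    [/\ 0 < e1, e1 <= k%:R^-1 / 2 & k%:R * e1 = k%:R^-1].
  exists (k%:R^-1 * k%:R^-1); split; first by rewrite mulr_gt0.
    by rewrite ler_wpM2l// ltW.
  by rewrite mulrA divff ?mul1r// gt_eqF.
have [K1 H1] := xY e10; have [K2 H2] := yY e10.
exists (2 * (K1 + K2) + k)%N => j M Kj KM.
have KM1 : (K1 <= M)%N by lia.
have [d [d1 dj kd jdk' Kjd]] := small_block k2 Kj.
have dle : (d <= j)%N by lia.
have [K1jd K2jd] : (K1 <= j - d)%N /\ (K2 <= j - d)%N by lia.
have K1j : (K1 <= j)%N := leq_trans K1jd (leq_subr _ _).
have K1jD : (K1 <= j + d)%N := leq_trans K1j (leq_addr _ _).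
have K2jD : (K2 <= j + d)%N.
  exact: leq_trans (leq_trans K2jd (leq_subr _ _)) (leq_addr _ _).
have jd : (j - d + d = j)%N by rewrite subnK.
have dR : 0 < d%:R :> R by rewrite ltr0n.
have j0 : 0 < j%:R :> R by rewrite ltr0n (leq_trans d1).
have jdk : j%:R <= 2 * k%:R * d%:R :> R by rewrite -!natrM ler_nat.
have dk : d%:R <= j%:R / k%:R :> R by rewrite ler_pdivlMr// -natrM ler_nat.
have dj2 : d%:R * 2 <= j%:R :> R by rewrite -natrM ler_nat mulnC.
have Y0 n : 0 <= Y n by rewrite sumr_ge0.
have Ymono m n : (m <= n)%N -> Y m <= Y n by move=> mn; exact: sum_le_widen.
have yle n : n%:R * y n <= Y n.
  have /andP[+ _] := @block_sum_le y 0 n yn.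
  by rewrite add0n big_ord0 subr0.
pose X n := \sum_(i < n) x i M.
have HX n : (K1 <= n)%N -> Y n - e1 * Y n <= X n <= Y n + e1 * Y n.
  by move=> nK; have := H1 n M nK KM1; rewrite ler_distl.
have HY n : (K2 <= n)%N -> sigma * Y n - e1 * Y n <= n%:R * y n <= sigma * Y n + e1 * Y n.
  by move=> nK; have := H2 n nK; rewrite ler_distl.
have /andP[upx _] := @block_sum_le (x^~ M) (j - d) d (xn M).
have /andP[_ upy] := @block_sum_le y (j - d) d yn.
have /andP[_ lox] := @block_sum_le (x^~ M) j d (xn M).
have /andP[loy _] := @block_sum_le y j d yn.
rewrite jd -/(X j) -/(X (j - d)%N) in upx; rewrite jd -/(Y j) -/(Y (j - d)%N) in upy.
rewrite -/(X j) -/(X (j + d)%N) in lox; rewrite -/(Y j) -/(Y (j + d)%N) in loy.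
have /andP[Xj1 Xj2] : Y j - e1 * Y j <= X j <= Y j + e1 * Y j by exact: HX.
have /andP[Xd1 Xd2] : Y (j - d)%N - e1 * Y (j - d)%N <= X (j - d)%N <=
  Y (j - d)%N + e1 * Y (j - d)%N by exact: HX.
have /andP[XD1 XD2] : Y (j + d)%N - e1 * Y (j + d)%N <= X (j + d)%N <=
  Y (j + d)%N + e1 * Y (j + d)%N by exact: HX.
have /andP[_ Yd2] : sigma * Y (j - d)%N - e1 * Y (j - d)%N <= (j - d)%:R * y (j - d)%N <=
  sigma * Y (j - d)%N + e1 * Y (j - d)%N by exact: HY.
have /andP[YD1 _] : sigma * Y (j + d)%N - e1 * Y (j + d)%N <= (j + d)%:R * y (j + d)%N <=
  sigma * Y (j + d)%N + e1 * Y (j + d)%N by exact: HY.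
have mul_e (u v : R) : u <= v -> e1 * u <= e1 * v by move=> uv; rewrite ler_wpM2l// ltW.
have mul_s (u v : R) : u <= v -> sigma * u <= sigma * v by move=> uv; rewrite ler_wpM2l.
have Ydj := Ymono (j - d)%N j (leq_subr _ _).
have YjD := Ymono j (j + d)%N (leq_addr _ _).
(* the estimates are first obtained for d x_j, and then multiplied by j / d <= 2 k *)
have scale (c : R) : 0 <= c -> j%:R / d%:R * (e1 * c) <= 2 * k%:R^-1 * c.
  move=> c0; have -> : 2 * k%:R^-1 * c = 2 * k%:R * (e1 * c) by rewrite -ke1; ring.
  by rewrite ler_wpM2r ?mulr_ge0 ?(ltW e10)// ler_pdivrMr.
have jd0 : 0 < j%:R / d%:R :> R by rewrite divr_gt0.
have unscale (c : R) : j%:R / d%:R * (d%:R * c) = j%:R * c by field; rewrite gt_eqF.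
have upper : j%:R * x j M <= sigma * Y j + eps * Y j.
  have E1 : d%:R * x j M <= d%:R * y (j - d)%N + 2 * (e1 * Y j).
    by have := mul_e _ _ Ydj; lra.
  have E2 : j%:R * x j M <= j%:R * y (j - d)%N + 4 * k%:R^-1 * Y j.
    rewrite -[j%:R * x j M]unscale -[j%:R * y _]unscale.
    apply: le_trans (ler_wpM2l (ltW jd0) E1) _; rewrite mulrDr lerD2l.
    by have := scale _ (Y0 j); rewrite mulrCA; lra.
  have E3 : d%:R * y (j - d)%N <= 2 * k%:R^-1 * Y j.
    have E4 : d%:R <= 2 * k%:R^-1 * (j - d)%:R :> R.
      rewrite natrB//; have : j%:R / k%:R / 2 <= k%:R^-1 * (j%:R - d%:R) :> R.
        have -> : j%:R / k%:R / 2 = k%:R^-1 * (j%:R / 2) :> R by ring.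
        by rewrite ler_wpM2l ?(ltW ik0)//; lra.
      by lra.
    apply: le_trans (ler_wpM2r (y0 _) E4) _; rewrite -[leLHS]mulrA ler_wpM2l//.
    by rewrite (le_trans (yle _)).
  have E5 : j%:R * y (j - d)%N = (j - d)%:R * y (j - d)%N + d%:R * y (j - d)%N.
    by rewrite -mulrDl -natrD jd.
  have := mul_e _ _ Ydj; have := mul_s _ _ Ydj.
  have : e1 * Y j <= k%:R^-1 / 2 * Y j by rewrite ler_wpM2r.
  have : 9 / k%:R * Y j <= eps * Y j by rewrite ler_wpM2r.
  have : 0 <= k%:R^-1 * Y j by rewrite mulr_ge0// ltW.
  by lra.
have dyj : d%:R * y j <= k%:R^-1 * Y j.
  apply: le_trans (ler_wpM2r (y0 j) dk) _.
  have -> : j%:R / k%:R * y j = k%:R^-1 * (j%:R * y j) by ring.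
  by rewrite ler_wpM2l ?(ltW ik0).
have YD : Y (j + d)%N <= 2 * Y j.
  have /andP[_] := @block_sum_le y j d yn; rewrite -/(Y j) -/(Y (j + d)%N) => H.
  have : k%:R^-1 * Y j <= 2^-1 * Y j by rewrite ler_wpM2r.
  by have := Y0 j; lra.
have lower : sigma * Y j - eps * Y j <= j%:R * x j M.
  have E1 : d%:R * y (j + d)%N - 3 * (e1 * Y j) <= d%:R * x j M.
    by have := mul_e _ _ YD; lra.
  have E2 : j%:R * y (j + d)%N - 6 * k%:R^-1 * Y j <= j%:R * x j M.
    rewrite -[j%:R * x j M]unscale -[j%:R * y _]unscale.
    apply: le_trans (ler_wpM2l (ltW jd0) E1); rewrite mulrBr lerD2l lerN2.
    by have := scale _ (Y0 j); rewrite mulrCA; lra.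
  have E3 : d%:R * y (j + d)%N <= k%:R^-1 * Y j.
    by apply: le_trans dyj; rewrite ler_wpM2l ?(ltW dR)// nonincreasing_le// leq_addr.
  have E5 : (j + d)%:R * y (j + d)%N = j%:R * y (j + d)%N + d%:R * y (j + d)%N.
    by rewrite natrD mulrDl.
  have := mul_e _ _ YD; have := mul_s _ _ YjD.
  have : e1 * Y j <= k%:R^-1 / 2 * Y j by rewrite ler_wpM2r.
  have : 9 / k%:R * Y j <= eps * Y j by rewrite ler_wpM2r.
  have : 0 <= k%:R^-1 * Y j by rewrite mulr_ge0// ltW.
  by lra.
by rewrite ler_distl lower upper.
Qed.

End monotone_density.

(** * Steps in both directions *)

Section signs.
Context {R : realType} (E : @word_law R).

Definition gt0_prob k : R := E k (fun y => (0 < wsum y)%R%:R).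

Lemma good_pos (g : seq R -> R) : wmeas g -> good (fun y => (0 < g y)%R%:R).
Proof. by move=> mg; apply: good_ind; apply: (wbmeas_pos true). Qed.

Let mw := @wmeas_wsum R.

Lemma wmeas_head : wmeas (fun y : seq R => head 0 y).
Proof. by move=> n; under eq_fun => y do rewrite -nth0; exact: (wmeas_nth 0). Qed.

Lemma gt0_prob_eq0 : E 1 (fun y => (0 < head 0 y)%R%:R) = 0 -> forall k, gt0_prob k = 0.
Proof.
move=> h0; elim=> [|k IH].
  rewrite /gt0_prob -[RHS](wE_cst E 0); apply: wE_ext => y /size0nil ->.
  by rewrite /wsum big_nil ltxx.
apply/eqP; rewrite eq_le; apply/andP; split; last first.
  by apply: wE_ge0 => //; exact: good_pos.
have gh := good_pos wmeas_head; have gw := good_pos mw.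
apply: (@le_trans _ _ (E k.+1 (fun y => (0 < head 0 (take 1 y))%R%:R +
    (0 < wsum (drop 1 y))%R%:R))).
  apply: wE_le => //; first by apply: goodD; [exact: (good_take 1 gh)|exact: (good_drop 1 gw)].
  move=> [//|x w] _; rewrite /= drop0 /wsum big_cons -/(wsum w).
  rewrite -natrD ler_nat; have [x0|x0] := ltP 0 x; first by rewrite (leq_trans (leq_b1 _)).
  have [w0|w0] := ltP 0 (wsum w); first by rewrite (leq_trans (leq_b1 _)).
  by rewrite ltNge (_ : _ <= 0)//; lra.
rewrite wED; [|exact: (good_take 1 gh)|exact: (good_drop 1 gw)].
by rewrite (wE_take E gh)// h0 add0r (wE_drop E gw)// subn1 /= -/(gt0_prob k) IH.
Qed.

End signs.

Section decay.
Context {R : realType} (E : @word_law R).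

Lemma mirror_head :
  mirror_law E 1 (fun y => (0 < head 0 y)%R%:R) = E 1 (fun y => (0 < - head 0 y)%R%:R).
Proof.
by apply: (@wE_ext _ E 1 (fun y => (0 < head 0 (map -%R y))%R%:R)) => -[|x []].
Qed.

Lemma mirror_gt0_prob k : gt0_prob (mirror_law E) k = E k (fun y => (0 < - wsum y)%R%:R).
Proof.
by apply: (@wE_ext _ E k (fun y => (0 < wsum (map -%R y))%R%:R)) => y _; rewrite wsum_opp.
Qed.

(** Up to a null event, the walk fails to be positive only as long as no step has been
    positive. *)
Lemma npos_prob_decay : E 1 (fun y => (0 < - head 0 y)%R%:R) = 0 ->
  forall k, npos_prob E true k <= (1 - E 1 (fun y => (0 < head 0 y)%R%:R)) ^+ k.
Proof.
move=> h0; have z0 k : E k (fun y => (0 < - wsum y)%R%:R) = 0.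
  by rewrite -mirror_gt0_prob; apply: gt0_prob_eq0; rewrite mirror_head.
have gh := good_pos (@wmeas_head R).
have gnh := good_pos (wmeasN (@wmeas_head R)).
have gnw := good_pos (wmeasN (@wmeas_wsum R)).
have gw := @good_npos_wsum R true.
have ghn : good (fun y : seq R => (~~ (0 < head 0 y)%R)%:R).
  by apply: good_ind; apply: wbmeasN; apply: (wbmeas_pos true); exact: wmeas_head.
set c := 1 - _; have cE : c = E 1 (fun y => (~~ (0 < head 0 y)%R)%:R).
  apply/eqP; rewrite /c subr_eq -wED//; apply/eqP.
  rewrite -[LHS](wE_cst E 1); apply: wE_ext => y _.
  by case: (0 < _); rewrite /= ?addr0 ?add0r.
have c0 : 0 <= c by rewrite cE; apply: wE_ge0.
elim=> [|k IH].
  by rewrite expr0 -[leRHS](wE_cst E 0); apply: wE_le => // [|y _];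
    [exact: good_cst|case: (~~ _)].
have H : npos_prob E true k.+1 <= c * npos_prob E true k.
  have -> : c * npos_prob E true k = E k.+1 (fun y => (~~ (0 < head 0 (take 1 y))%R)%:R *
      (~~ pos true (wsum (drop 1 y)))%:R + ((0 < - head 0 (take 1 y))%R%:R +
      (0 < - wsum (drop 1 y))%R%:R)).
    rewrite wED; last 2 first.
      exact: (goodM (good_take 1 ghn) (good_drop 1 gw)).
      exact: (goodD (good_take 1 gnh) (good_drop 1 gnw)).
    rewrite wED; [|exact: (good_take 1 gnh)|exact: (good_drop 1 gnw)].
    rewrite (wE_take E gnh)// h0 (wE_drop E gnw)// subn1 /= z0 !addr0 cE.
    by rewrite -(wE_cat E 1 k ghn gw).
  apply: wE_le => //.
    apply: goodD; first exact: (goodM (good_take 1 ghn) (good_drop 1 gw)).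
    exact: (goodD (good_take 1 gnh) (good_drop 1 gnw)).
  move=> [//|x w] _; rewrite /= drop0 /wsum big_cons -/(wsum w).
  rewrite -natrM -!natrD ler_nat !oppr_gt0.
  have [x0|x0|->] := ltgtP x 0; have [w0|w0|->] := ltgtP (wsum w) 0;
    rewrite ?addr0 ?add0r ?ltxx //=; try exact: leq_b1; try exact: leq_trans (leq_b1 _) _.
  all: try by rewrite ?w0 ?x0 ?addr_gt0.
by apply: le_trans H _; rewrite exprS ler_wpM2l.
Qed.

End decay.

(** * Asymptotics of the mean degree *)

(** [Elow_pos] and [pre_post_sum1] are the two convolution identities of
    [renewal_identity]. *)
Lemma pre_prob_density {R : realType} (E : @word_law R) s (sigma : R) :
  0 < sigma <= 1 ->
  (forall eps, 0 < eps -> exists N, forall n, (N <= n)%N ->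
     `|\sum_(i < n) npos_prob E s i.+1 - sigma * n%:R| <= eps * n%:R) ->
  forall eps, 0 < eps -> exists N, forall n, (N <= n)%N ->
    `|n%:R * pre_prob E s n - sigma * pre_sum E s n| <= eps * pre_sum E s n.
Proof.
move=> s01 Hq; apply: (@density_ratio _ (pre_prob E s) (npos_prob E s)) => //.
- exact: pre_prob_ge0.
- exact: pre_prob_noninc.
- by apply: (renewal_identity (post_prob0 E s)); [exact: pre_post_sum1|exact: Elow_pos].
move=> k; apply/andP; split; first by apply: wE_ge0 => //; exact: good_npos_wsum.
rewrite -[leRHS](wE_cst E k); apply: wE_le => [| |y _].
- exact: good_npos_wsum.
- exact: good_cst.
- by case: (~~ _).
Qed.

Lemma cvg_min_infty {R : realType} (f : nat -> nat -> R) l :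
  (forall eps, 0 < eps -> exists K, forall J M, (K <= J)%N -> (K <= M)%N ->
     `|f J M - l| <= eps) ->
  f nj.2 (nj.1 - nj.2)%N @[nj --> min_infty] --> l.
Proof.
move=> H; apply/cvgrPdist_le => eps eps0; have [K HK] := H eps eps0.
exists K => // nj /=; rewrite leq_min distrC => /andP[]; exact: HK.
Qed.

Section abstract_limit.
Context {R : realType} (E : @word_law R) (rho : R).
Hypothesis rho01 : 0 < rho < 1.
Hypothesis cesaro_gt0 : forall eps : R, 0 < eps -> exists N, forall n, (N <= n)%N ->
  `|\sum_(i < n) gt0_prob E i.+1 - rho * n%:R| <= eps * n%:R.

Lemma gt0_npos_prob k : gt0_prob E k = 1 - npos_prob E true k.
Proof.
apply/eqP; rewrite eq_sym subr_eq -wED; [|exact: (@good_pos_wsum R true)|exact: good_npos_wsum].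
apply/eqP; rewrite -[LHS](wE_cst E k); apply: wE_ext => y _ /=.
by case: (0 < _); rewrite /= ?addr0 ?add0r.
Qed.

Let p_up := E 1 (fun y => (0 < head 0 y)%R%:R).
Let p_down := E 1 (fun y => (0 < - head 0 y)%R%:R).

Let p_up_ge0 : 0 <= p_up.
Proof. by apply: wE_ge0 => //; apply: good_pos; exact: wmeas_head. Qed.

Let p_down_ge0 : 0 <= p_down.
Proof. by apply: wE_ge0 => //; apply: good_pos; apply: wmeasN; exact: wmeas_head. Qed.

Lemma step_up_gt0 : 0 < p_up.
Proof.
rewrite lt_neqAle p_up_ge0 andbT eq_sym; apply/eqP => h0.
have /andP[r0 _] := rho01; have r2 : 0 < rho / 2 by rewrite divr_gt0.
have [N /(_ N.+1 (leqnSn N))] := cesaro_gt0 r2.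
rewrite big1 => [|i _]; last exact: gt0_prob_eq0.
rewrite sub0r normrN ger0_norm ?mulr_ge0 ?(ltW r0)//.
rewrite ler_pM2r ?ltr0n//; lra.
Qed.

(** Otherwise the walk would fail to be positive only a summable number of times, and
    the averages in Spitzer's condition would tend to one. *)
Lemma step_down_gt0 : 0 < p_down.
Proof.
rewrite lt_neqAle p_down_ge0 andbT eq_sym; apply/eqP => h0.
have /andP[r0 r1] := rho01; have h1 := step_up_gt0.
have r2 : 0 < (1 - rho) / 2 by rewrite divr_gt0// subr_gt0.
have qle := npos_prob_decay h0; rewrite -/p_up in qle; set c := 1 - p_up in qle.
have c0 : 0 <= c.
  rewrite -[c]expr1 (le_trans _ (qle 1%N))//; apply: wE_ge0 => //; exact: good_npos_wsum.
have geom n : p_up * \sum_(i < n) c ^+ i = 1 - c ^+ n.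
  elim: n => [|n IH]; first by rewrite big_ord0 mulr0 expr0 subrr.
  by rewrite big_ord_recr /= mulrDr IH exprS /c; ring.
have qsum n : \sum_(i < n) npos_prob E true i.+1 <= p_up^-1.
  rewrite -[leRHS]mulr1 ler_pdivlMl//.
  apply: (@le_trans _ _ (p_up * \sum_(i < n) c ^+ i)).
    rewrite ler_wpM2l//; apply: ler_sum => i _; rewrite (le_trans (qle _))//.
    by rewrite exprS ler_piMl ?exprn_ge0// /c gerBl.
  by rewrite geom gerBl exprn_ge0.
have [N HN] := cesaro_gt0 r2.
pose n := (N + (Num.trunc (p_up^-1 / ((1 - rho) / 2))).+1)%N.
have nbig : p_up^-1 < n%:R * ((1 - rho) / 2).
  rewrite -ltr_pdivrMr//; apply: lt_le_trans (truncnS_gt _) _.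
  by rewrite ler_nat leq_addl.
have := HN n (leq_addr _ _); rewrite ler_distl => /andP[_].
under eq_bigr => i _ do rewrite gt0_npos_prob.
rewrite sumrB sumr_const card_ord; have := qsum n; lra.
Qed.

Lemma renewal_bound s : exists2 D : R, 0 <= D &
  (forall L, \sum_(l < L) post_tilt E s l <= D) /\ (forall L, \sum_(l < L) pre_tilt E s l <= D).
Proof.
have [D1 D10 H1] := post_tilt_bounded s step_up_gt0.
have hm : 0 < mirror_law E 1 (fun y => (0 < head 0 y)%R%:R).
  by rewrite mirror_head; exact: step_down_gt0.
have [D2 D20 H2] := post_tilt_bounded (~~ s) hm.
exists (D1 + D2); first exact: addr_ge0.
split=> L; first by rewrite (le_trans (H1 L))// lerDl.
under eq_bigr => l _ do rewrite -post_tilt_mirror.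
by rewrite (le_trans (H2 L))// lerDr.
Qed.

Lemma post_sum_gt0 s M : (0 < M)%N -> 0 < post_sum E s M.
Proof.
case: M => // M _; rewrite /post_sum big_ord_recl post_prob0 ltr_pwDl// sumr_ge0// => i _.
exact: post_prob_ge0.
Qed.

Lemma pre_sum_gt0 s M : (0 < M)%N -> 0 < pre_sum E s M.
Proof.
case: M => // M _; rewrite /pre_sum big_ord_recl pre_prob0 ltr_pwDl// sumr_ge0// => i _.
exact: pre_prob_ge0.
Qed.

(** The left side does not depend on the convention [s] for ties. *)
Lemma degree_sum_equiv s (eps : R) : 0 < eps -> exists K, forall J M,
  (K <= J)%N -> (K <= M)%N ->
  `|degree_sum E J M - pre_sum E s J * post_sum E s M| <= eps *
    (pre_sum E s J * post_sum E s M).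
Proof.
move=> eps0; have [D D0 [Da Db]] := renewal_bound s.
pose x l := D * (post_tilt E s l + pre_tilt E s l).
have x0 l : 0 <= x l by rewrite mulr_ge0// addr_ge0 ?post_tilt_ge0 ?pre_tilt_ge0.
have xD L : \sum_(l < L) x l <= D * (D + D).
  rewrite /x -mulr_sumr big_split /= ler_wpM2l//; exact: lerD (Da L) (Db L).
have e2 : 0 < eps / 2 by rewrite divr_gt0.
have [K HK] := capped_ratio_sum_small x0 xD e2.
exists K.+1 => J M KJ KM; have [J0 M0] : (0 < J)%N /\ (0 < M)%N by lia.
apply: le_trans (transport J0 M0 Da Db) _; rewrite mulrC ler_wpM2r//.
  by rewrite mulr_ge0// ltW// ?pre_sum_gt0 ?post_sum_gt0.
have -> : D * (\sum_(l < J + M) (post_tilt E s l + pre_tilt E s l) * (capped_ratio l J +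
  capped_ratio l M)) =
    \sum_(l < J + M) x l * capped_ratio l J + \sum_(l < J + M) x l * capped_ratio l M.
  by rewrite -big_split mulr_sumr; apply: eq_bigr => l _; rewrite /x /=; ring.
by have := HK J (J + M)%N (ltnW KJ); have := HK M (J + M)%N (ltnW KM); lra.
Qed.

(** Both products are equivalent to the same [degree_sum]. *)
Lemma prod_sum_equiv (eps : R) : 0 < eps -> exists K, forall J M, (K <= J)%N -> (K <= M)%N ->
  `|pre_sum E false J * post_sum E false M - pre_sum E true J * post_sum E true M| <=
    eps * (pre_sum E true J * post_sum E true M).
Proof.
move=> eps0; pose e := Num.min (1 / 2) (eps / 4).
have e0 : 0 < e by rewrite lt_min !divr_gt0.
have e1 : e <= 1 / 2 by rewrite ge_min lexx.
have e2 : e <= eps / 4 by rewrite ge_min lexx orbT.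
have [K1 H1] := degree_sum_equiv false e0; have [K2 H2] := degree_sum_equiv true e0.
exists (K1 + K2).+1 => J M KJ KM; have [J0 M0] : (0 < J)%N /\ (0 < M)%N by lia.
have [[K1J K1M] [K2J K2M]] : ((K1 <= J)%N /\ (K1 <= M)%N) /\
  ((K2 <= J)%N /\ (K2 <= M)%N) by lia.
have := H1 J M K1J K1M; have := H2 J M K2J K2M.
have : 0 < pre_sum E true J * post_sum E true M by rewrite mulr_gt0 ?pre_sum_gt0 ?post_sum_gt0.
have : 0 < pre_sum E false J * post_sum E false M by rewrite mulr_gt0 ?pre_sum_gt0 ?post_sum_gt0.
set u := pre_sum E false J * _; set v := pre_sum E true J * _; set F := degree_sum _ _ _ => u0 v0.
rewrite !ler_distl => /andP[f1 f2] /andP[f3 f4].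
have eu : e * u <= 1 / 2 * u by rewrite ler_wpM2r// ltW.
have ev : e * v <= 1 / 2 * v by rewrite ler_wpM2r// ltW.
have u3v : u <= 3 * v by lra.
have : e * u <= e * (3 * v) by rewrite ler_wpM2l// ltW.
have : e * v <= eps / 4 * v by rewrite ler_wpM2r// ltW.
by move=> ? ?; apply/andP; split; lra.
Qed.

Lemma pre_prob_true_density (eps : R) : 0 < eps -> exists N, forall n, (N <= n)%N ->
  `|n%:R * pre_prob E true n - (1 - rho) * pre_sum E true n| <= eps * pre_sum E true n.
Proof.
have /andP[r0 r1] := rho01.
apply: pre_prob_density; first by apply/andP; split; lra.
move=> e e0; have [N HN] := cesaro_gt0 e0; exists N => n Nn.
have := HN n Nn; under eq_bigr => i _ do rewrite gt0_npos_prob.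
rewrite sumrB sumr_const card_ord -normrN; apply: le_trans.
by rewrite le_eqVlt; apply/orP; left; apply/eqP; congr `|_|; ring.
Qed.

Lemma post_prob_true_density (eps : R) : 0 < eps -> exists N, forall n, (N <= n)%N ->
  `|n%:R * post_prob E true n - rho * post_sum E true n| <= eps * post_sum E true n.
Proof.
have /andP[r0 r1] := rho01 => eps0.
have [||N HN] := @pre_prob_density _ (mirror_law E) false rho _ _ eps eps0.
- by apply/andP; split; lra.
- move=> e e0; have [N HN] := cesaro_gt0 e0; exists N => n Nn.
  by have := HN n Nn; under eq_bigr => i _ do rewrite -[gt0_prob _ _](npos_prob_mirror E true).
exists N => n Nn; have := HN n Nn.
by rewrite (pre_prob_mirror E true) (pre_sum_mirror E true).
Qed.

Let ratio_cvg (x : nat -> nat -> R) (y k : nat -> R) (sigma : R) :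
  (forall M, nonincreasing (x^~ M)) -> (forall j, 0 <= y j) -> nonincreasing y -> y 0%N = 1 ->
  0 <= sigma ->
  (forall eps, 0 < eps -> exists K, forall J M, (K <= J)%N -> (K <= M)%N ->
     `|\sum_(j < J) x j M - \sum_(j < J) y j| <= eps * \sum_(j < J) y j) ->
  (forall eps, 0 < eps -> exists N, forall n, (N <= n)%N ->
     `|n%:R * y n - sigma * \sum_(j < n) y j| <= eps * \sum_(j < n) y j) ->
  forall eps, 0 < eps -> exists K, forall J M, (K <= J)%N -> (K <= M)%N ->
    `|J%:R * x J M / (\sum_(j < J) y j) - sigma| <= eps.
Proof.
move=> xn y0 yn y00 s0 xY yY eps eps0.
have [K HK] := monotone_density xn y0 yn s0 xY yY eps0.
exists K.+1 => J M KJ KM; have := HK J M (ltnW KJ) (ltnW KM).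
have Y0 : 0 < \sum_(j < J) y j.
  case: J KJ => // J _; rewrite big_ord_recl y00 ltr_pwDl// sumr_ge0// => i _.
set Y := \sum_(j < J) y j in Y0 *.
have -> : J%:R * x J M / Y - sigma = (J%:R * x J M - sigma * Y) / Y.
  by field; rewrite gt_eqF.
by rewrite normrM normfV (gtr0_norm Y0) ler_pdivrMr.
Qed.

Definition degree_mean j M : R := \sum_(m < M) E (j + m)%N (share j).

Let div_dist (u v k eps : R) : 0 < k -> `|u - v * k| <= eps * (v * k) ->
  `|u / k - v| <= eps * v.
Proof.
move=> k0 H; have -> : u / k - v = (u - v * k) / k by field; rewrite gt_eqF.
by rewrite normrM normfV (gtr0_norm k0) ler_pdivrMr// -mulrA.
Qed.

(** The densities are known for the strict convention, in which Spitzer's condition is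
    stated; the next three limits compare the mean degree and the probabilities of the
    weak convention with [post_sum E true M * pre_sum E true J]. *)
Let ratio_G (eps : R) : 0 < eps -> exists K, forall J M, (K <= J)%N -> (K <= M)%N ->
  `|J%:R * (degree_mean J M / post_sum E true M) / pre_sum E true J - (1 - rho)| <= eps.
Proof.
have /andP[r0 r1] := rho01.
apply: (@ratio_cvg (fun j M => degree_mean j M / post_sum E true M) (pre_prob E true)) => //.
- move=> M j; rewrite ler_wpM2r//.
    by rewrite invr_ge0 sumr_ge0// => i _; exact: post_prob_ge0.
  by apply: ler_sum => m _; exact: Eshare_noninc.
- exact: pre_prob_ge0.
- exact: pre_prob_noninc.
- exact: pre_prob0.
- by lra.
- move=> e e0; have [K HK] := degree_sum_equiv true e0; exists K.+1 => J M KJ KM.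
  have A0 : 0 < post_sum E true M by apply: post_sum_gt0; lia.
  rewrite -mulr_suml; apply: div_dist => //.
  exact: (HK J M (ltnW KJ) (ltnW KM)).
- exact: pre_prob_true_density.
Qed.

Let ratio_b (eps : R) : 0 < eps -> exists K, forall J M, (K <= J)%N -> (K <= M)%N ->
  `|J%:R * (pre_prob E false J * post_sum E false M / post_sum E true M) /
    pre_sum E true J - (1 - rho)| <= eps.
Proof.
have /andP[r0 r1] := rho01.
apply: (@ratio_cvg (fun j M => pre_prob E false j * post_sum E false M /
  post_sum E true M) (pre_prob E true)) => //.
- move=> M j; rewrite ler_wpM2r//.
    by rewrite invr_ge0 sumr_ge0// => i _; exact: post_prob_ge0.
  by rewrite ler_wpM2r ?pre_prob_noninc// sumr_ge0// => i _; exact: post_prob_ge0.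
- exact: pre_prob_ge0.
- exact: pre_prob_noninc.
- exact: pre_prob0.
- by lra.
- move=> e e0; have [K HK] := prod_sum_equiv e0; exists K.+1 => J M KJ KM.
  have A0 : 0 < post_sum E true M by apply: post_sum_gt0; lia.
  rewrite -!mulr_suml; apply: div_dist => //.
  exact: (HK J M (ltnW KJ) (ltnW KM)).
- exact: pre_prob_true_density.
Qed.

Let ratio_a (eps : R) : 0 < eps -> exists K, forall M J, (K <= M)%N -> (K <= J)%N ->
  `|M%:R * (post_prob E false M * pre_sum E false J / pre_sum E true J) /
    post_sum E true M - rho| <= eps.
Proof.
have /andP[r0 r1] := rho01.
apply: (@ratio_cvg (fun m J => post_prob E false m * pre_sum E false J /
  pre_sum E true J) (post_prob E true)) => //.
- move=> M j; rewrite ler_wpM2r//.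
    by rewrite invr_ge0 sumr_ge0// => i _; exact: pre_prob_ge0.
  by rewrite ler_wpM2r ?post_prob_noninc// sumr_ge0// => i _; exact: pre_prob_ge0.
- exact: post_prob_ge0.
- exact: post_prob_noninc.
- exact: post_prob0.
- by lra.
- move=> e e0; have [K HK] := prod_sum_equiv e0; exists K.+1 => M J KM KJ.
  have B0 : 0 < pre_sum E true J by apply: pre_sum_gt0; lia.
  rewrite -!mulr_suml; apply: div_dist => //.
  have := HK J M (ltnW KJ) (ltnW KM).
  by rewrite ![_ * post_sum E _ M]mulrC.
- exact: post_prob_true_density.
Qed.

Let ratio_AB (eps : R) : 0 < eps -> exists K, forall J M, (K <= J)%N -> (K <= M)%N ->
  `|pre_sum E false J * post_sum E false M / (pre_sum E true J * post_sum E true M) - 1| <= eps.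
Proof.
move=> e0; have [K HK] := prod_sum_equiv e0; exists K.+1 => J M KJ KM.
have P0 : 0 < pre_sum E true J * post_sum E true M.
  by rewrite mulr_gt0 ?pre_sum_gt0 ?post_sum_gt0//; lia.
rewrite -[eps]mulr1; apply: div_dist => //; rewrite mul1r.
exact: (HK J M (ltnW KJ) (ltnW KM)).
Qed.

(** The quotient is [ratio_G * ratio_AB / (ratio_b * ratio_a)]: the factor [1 - rho] of
    the density in [j] cancels and the density [rho] in the number of later steps
    remains. *)
Theorem degree_mean_equiv :
  degree_mean nj.2 (nj.1 - nj.2)%N /
    ((nj.1 - nj.2)%:R * pre_prob E false nj.2 * post_prob E false (nj.1 - nj.2)%N)
  @[nj --> min_infty] --> rho^-1.
Proof.
have /andP[r0 r1] := rho01.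
have cG := cvg_min_infty ratio_G; have cb := cvg_min_infty ratio_b.
have cAB := cvg_min_infty ratio_AB.
have ca : (fun nj : nat * nat => (nj.1 - nj.2)%:R * (post_prob E false (nj.1 - nj.2)%N *
    pre_sum E false nj.2 / pre_sum E true nj.2) /
      post_sum E true (nj.1 - nj.2)%N) @ min_infty --> rho.
  apply: (cvg_min_infty (f := fun J M => M%:R * (post_prob E false M *
    pre_sum E false J / pre_sum E true J) / post_sum E true M)) => eps eps0.
  by have [K HK] := ratio_a eps0; exists K => J M KJ KM; exact: HK.
have rhoE : rho^-1 = (1 - rho) * 1 / ((1 - rho) * rho).
  by field; rewrite !gt_eqF// subr_gt0.
rewrite rhoE; apply: cvg_trans (cvgM (cvgM cG cAB) (cvgV _ (cvgM cb ca))); last first.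
  by rewrite mulf_neq0 ?gt_eqF// subr_gt0.
apply: near_eq_cvg; exists 1%N => // -[n j] /=; rewrite leq_min => /andP[j0 m0].
set M := (n - j)%N in m0 *.
have [Af At] : post_sum E false M != 0 /\ post_sum E true M != 0 by rewrite !gt_eqF ?post_sum_gt0.
have [Bf Bt] : pre_sum E false j != 0 /\ pre_sum E true j != 0 by rewrite !gt_eqF ?pre_sum_gt0.
have jn : j%:R != 0 :> R by rewrite pnatr_eq0 -lt0n.
rewrite !invfM; move: (pre_prob E false j)^-1 (post_prob E false M)^-1 (M%:R^-1) => u v w.
by rewrite !invrK; field; rewrite Af At Bf Bt jn.
Qed.

End abstract_limit.

(** * Translation to the random tree *)

Section big_extremum.
Context {R : realType} (I : Type).

Lemma bigmax_lt_all (r : seq I) (F : I -> R) a c :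
  (\big[Num.max/a]_(i <- r) F i < c) = (a < c) && all (fun i => F i < c) r.
Proof.
elim: r => [|i r IH]; first by rewrite big_nil andbT.
by rewrite big_cons gt_max IH /= andbCA.
Qed.

Lemma le_bigmin_all (r : seq I) (F : I -> R) a c :
  (c <= \big[Num.min/a]_(i <- r) F i) = (c <= a) && all (fun i => c <= F i) r.
Proof.
elim: r => [|i r IH]; first by rewrite big_nil andbT.
by rewrite big_cons le_min IH /= andbCA.
Qed.

End big_extremum.

Section link.
Context d (T : measurableType d) (R : realType) (P : probability T R).
Variables (theta : nat -> {RV P >-> R}) (theta_iid : iid theta).
Local Notation S := (walk theta).
Let E := iid_word_law theta_iid.

Lemma psum_step_word n k x : (k <= n)%N -> psum (step_word theta n x) k = S k x.
Proof.
move=> kn; rewrite psumE /walk; apply: eq_bigr => i _.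
have i_n : (i < n)%N by exact: leq_trans (ltn_ord i) kn.
by rewrite -[LHS](tnth_nth 0 _ (Ordinal i_n)) tnth_mktuple.
Qed.

Lemma wsum_step_word n x : wsum (step_word theta n x) = S n x.
Proof. by rewrite -psum_size size_tuple psum_step_word. Qed.

Lemma gt0_prob_iid k : gt0_prob E k = fine (P [set x | 0 < S k x]).
Proof.
rewrite [LHS](Ew_ind theta k (wbmeas_pos true (@wmeas_wsum R))).
congr (fine (P _)); apply: eq_set => x; congr is_true.
by rewrite wsum_step_word.
Qed.

Lemma post_prob_iid m : post_prob E false m = fine (P [set x | 0 <= walk_min S m x]).
Proof.
rewrite [LHS](Ew_ind theta m (wbmeas_post false)); congr (fine (P _)).
apply: eq_set => x; congr is_true; rewrite /walk_min le_bigmin_all.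
have S0 : S 0 x = 0 by rewrite /walk big_ord0.
rewrite S0 lexx andTb; apply/postP/allP => px k.
  rewrite mem_index_iota ltnS => /andP[_ km].
  case: k km => [|k] km; first by rewrite S0.
  by have := px k.+1; rewrite size_tuple km psum_step_word// => /(_ isT).
rewrite size_tuple => /andP[_ km]; rewrite psum_step_word//.
by apply: px; rewrite mem_index_iota.
Qed.

Definition allneg (y : seq R) : bool :=
  all (fun k => ~~ pos false (psum y k.+1)) (iota 0 (size y)).

Lemma wbmeas_allneg : wbmeas allneg.
Proof.
apply: wbmeas_fixed => n.
exists (fun y => all (fun k => ~~ pos false (psum y k.+1)) (iota 0 n)).
  apply: (wbmeas_all (p := fun k y => ~~ pos false (psum y k.+1))) => k.
  by apply: wbmeasN; apply: wbmeas_pos; exact: wmeas_psum.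
by move=> y <-.
Qed.

(** The event of the theorem concerns the walk up to time [j]; time reversal identifies
    its probability with that of the past of a lowest point. *)
Lemma pre_rev y : pre false (rev y) = allneg y.
Proof.
have E1 k : (k <= size y)%N -> wsum (drop k (rev y)) = psum y (size y - k).
  by move=> ky; rewrite drop_rev wsum_rev.
apply/allP/allP => H k; rewrite ?size_rev mem_iota add0n => /andP[_ ky].
  have := H (size y - k.+1)%N; rewrite size_rev mem_iota E1 ?leq_subr// subKn//.
  by apply; lia.
rewrite E1 ?(ltnW ky)//; have := H (size y - k.+1)%N; rewrite mem_iota -subSn// subSS.
by apply; lia.
Qed.

Lemma pre_prob_iid j : (0 < j)%N ->
  pre_prob E false j = fine (P [set x | walk_max1 S j x < 0]).
Proof.
move=> j0; rewrite /pre_prob -(wE_rev E j (good_pre false)).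
rewrite (@wE_ext _ E j _ (fun y => (allneg y)%:R)); last by move=> y _; rewrite pre_rev.
rewrite [LHS](Ew_ind theta j wbmeas_allneg); congr (fine (P _)).
apply: eq_set => x; congr is_true; rewrite /walk_max1 bigmax_lt_all.
apply/allP/andP => [px|[_ /allP px] k].
  have H k : (0 < k <= j)%N -> S k x < 0.
    move=> /andP[k0 kj]; have := px k.-1; rewrite size_tuple mem_iota prednK//.
    by rewrite psum_step_word// -ltNge; apply.
  split; first by rewrite H.
  by apply/allP => k; rewrite mem_index_iota ltnS; exact: H.
rewrite size_tuple mem_iota add0n => /andP[_ kj].
by rewrite psum_step_word//= -ltNge; apply: px; rewrite mem_index_iota ltnS.
Qed.

Lemma cesaro_iid rho : spitzer P S rho ->
  forall eps, 0 < eps -> exists N, forall n, (N <= n)%N ->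
    `|\sum_(i < n) gt0_prob E i.+1 - rho * n%:R| <= eps * n%:R.
Proof.
move=> /cvgrPdist_le sp eps eps0; have [N _ HN] := sp _ eps0.
exists N.+1 => n Nn; have n0 : 0 < n%:R :> R by rewrite ltr0n; lia.
have : `|rho - n%:R^-1 * \sum_(i < n) gt0_prob E i.+1| <= eps.
  have sE : \sum_(i < n) gt0_prob E i.+1 =
      \sum_(1 <= k < n.+1) fine (P [set x | 0 < S k x]).
    by rewrite big_add1 big_mkord; apply: eq_bigr => i _; exact: gt0_prob_iid.
  by rewrite sE; exact: (HN n (ltnW Nn)).
set s := \sum_(i < n) _; have -> : s - rho * n%:R = - (rho - n%:R^-1 * s) * n%:R.
  by field; rewrite gt_eqF.
by rewrite normrM normrN (gtr0_norm n0) ler_pM2r.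
Qed.

Variables (star : nat -> {RV P >-> nat}).
Hypothesis star_tree : recursive_tree (weight S) star.

Lemma history_setT (w : nat -> T -> R) (st : nat -> T -> nat) n :
  history w st n setT.
Proof.
by move=> G [[G0 GC _] _]; have := GC _ G0; rewrite setD0.
Qed.

(** The defining property of the conditional probability, applied to the whole space. *)
Lemma prob_star k j : (j <= k)%N ->
  P (star k.+1 @^-1` [set j]) = (E k (share j))%:E.
Proof.
move=> jk; have [_ /(_ j jk)[_ /(_ setT) H]] := star_tree (ltn0Sn k).
move: H; rewrite setTI => ->; last by apply: history_setT.
rewrite [RHS](Ew_fin theta k (@good_share R j)).
apply: eq_integral => x _; congr (_%:E).
rewrite /weight /share size_tuple psum_step_word//; congr (_ / _).
by apply: eq_bigr => q _; rewrite psum_step_word// -ltnS.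
Qed.

Lemma outdegree_mean n j : (j <= n)%N ->
  fine 'E_P[outdegree R star n j] = degree_mean E j (n - j).
Proof.
move=> jn.
have mstar k : measurable (star k @^-1` [set j]).
  by rewrite -[X in measurable X]setTI; exact: measurable_funP.
have -> : ('E_P[outdegree R star n j] =
    \sum_(j.+1 <= k < n.+1) P (star k @^-1` [set j]))%E.
  rewrite unlock.
  transitivity (\int[P]_x \sum_(j.+1 <= k < n.+1) (\1_(star k @^-1` [set j]) x)%:E)%E.
    apply: eq_integral => x _; rewrite /outdegree -sumEFin; apply: eq_bigr => k _.
    rewrite indicE; case: eqP => xj; first by rewrite mem_set.
    by rewrite memNset.
  rewrite ge0_integral_sum//.
  - by apply: eq_bigr => k _; rewrite integral_indic// setIT.
  - move=> k; apply/measurable_EFinP; exact: measurable_indic.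
rewrite /degree_mean -[j.+1]add0n big_addn subSS big_mkord.
rewrite (eq_bigr (fun m : 'I__ => (E (j + m)%N (share j))%:E)); last first.
  by move=> m _; rewrite addnS addnC prob_star// leq_addr.
by rewrite sumEFin.
Qed.

End link.

Theorem theorem5 (d : measure_display) (T : measurableType d) (R : realType)
    (P : probability T R)
    (theta : nat -> {RV P >-> R}) (theta_iid : iid theta)
    (star : nat -> {RV P >-> nat})
    (star_tree : recursive_tree (weight (walk theta)) star)
    (rho : R) (rho01 : 0 < rho < 1)
    (spitzer_rho : spitzer P (walk theta) rho) :
  (fine 'E_P[outdegree R star nj.1 nj.2] /
     ((nj.1 - nj.2)%:R *
      fine (P [set x | walk_max1 (walk theta) nj.2 x < 0]) *
      fine (P [set x | 0 <= walk_min (walk theta) (nj.1 - nj.2) x])))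
    @[nj --> min_infty] --> rho^-1.
Proof.
have cesaro := cesaro_iid theta_iid spitzer_rho.
apply: cvg_trans (degree_mean_equiv rho01 cesaro); apply: near_eq_cvg.
exists 1%N => // -[n j] /=; rewrite leq_min => /andP[j0 m0].
rewrite (outdegree_mean theta_iid star_tree); last by lia.
by rewrite -(pre_prob_iid theta_iid j0) -(post_prob_iid theta_iid).
Qed.
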